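(* Let $\mathcal{K}=K_{\exp}\times\cdots\times K_{\exp}$ be a direct product of $m$ exponential cones in $\mathcal{E}=(\mathbb{R}^3)^m$, let $\mathcal{L}\subseteq\mathcal{E}$ be a subspace and $\mathbf{a}\in\mathcal{E}$ with $(\mathcal{L}+\mathbf{a})\cap\mathcal{K}\ne\emptyset$. Then the following hold. 1. The distance to the PPS condition of $\{\mathcal{K},\mathcal{L}+\mathbf{a}\}$ satisfies $d_{\mathrm{PPS}}(\mathcal{K},\mathcal{L}+\mathbf{a})\le m$. 2. If SANE (the simplifying assumption of non-exceptionality) is satisfied by $\mathcal{K}$ and $\mathcal{L}+\mathbf{a}$, then $\mathcal{K}$ and $\mathcal{L}+\mathbf{a}$ satisfy a uniform Hölderian error bound with exponent $2^{-d_{\mathrm{PPS}}(\mathcal{K},\mathcal{L}+\mathbf{a})}$.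
   Context: $\mathbb{R}^3$ and its powers carry the standard inner product and Euclidean norm; $\mathrm{d}(\mathbf{x},C)=\inf_{\mathbf{y}\in C}\|\mathbf{x}-\mathbf{y}\|$; $\mathrm{ri}$ denotes relative interior; $\mathcal{C}^*$ is the dual cone of $\mathcal{C}$. The exponential cone is $K_{\exp}=\{(x,y,z):y>0,\ z\ge ye^{x/y}\}\cup\{(x,y,z):x\le0,\ z\ge0,\ y=0\}$, and its exceptional face is $\mathcal{F}_\infty=\{(x,0,0):x\le0\}$. A face of a closed convex cone $\mathcal{K}$ is a closed convex cone $\mathcal{F}\subseteq\mathcal{K}$ such that $\mathbf{x},\mathbf{y}\in\mathcal{K}$, $\mathbf{x}+\mathbf{y}\in\mathcal{F}$ imply $\mathbf{x},\mathbf{y}\in\mathcal{F}$. A chain of faces of length $\ell$ is a sequence $\mathcal{F}_\ell\subsetneq\cdots\subsetneq\mathcal{F}_1$ of faces of $\mathcal{K}$. Faces of a direct product of cones are direct products of faces of the factors; the factors are called blocks. PPS (partial polyhedral Slater's) condition: for a closed convex cone $\mathcal{C}$ and an affine space $\mathcal{L}+\mathbf{a}$, $\{\mathcal{C},\mathcal{L}+\mathbf{a}\}$ satisfies the PPS condition if one of the following holds: 1) $(\mathcal{L}+\mathbf{a})\cap\mathrm{ri}\,\mathcal{C}\ne\emptyset$; 2) $(\mathcal{L}+\mathbf{a})\cap\mathcal{C}\ne\emptyset$ and $\mathcal{C}$ is polyhedral; 3) $\mathcal{C}$ can be written as a direct product $\mathcal{C}^1\times\mathcal{C}^2$ of cones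 in real Euclidean spaces (reordering factors if necessary) with $\mathcal{C}^1$ polyhedral and $(\mathcal{L}+\mathbf{a})\cap(\mathcal{C}^1\times\mathrm{ri}\,\mathcal{C}^2)\ne\emptyset$. The distance to the PPS condition $d_{\mathrm{PPS}}(\mathcal{K},\mathcal{L}+\mathbf{a})$ is the length minus one of the shortest chain of faces $\mathcal{F}_\ell\subsetneq\cdots\subsetneq\mathcal{F}_1=\mathcal{K}$ such that (iii): $\mathcal{F}_\ell\cap(\mathcal{L}+\mathbf{a})=\mathcal{K}\cap(\mathcal{L}+\mathbf{a})$ and $\{\mathcal{F}_\ell,\mathcal{L}+\mathbf{a}\}$ satisfies the PPS condition. SANE: $\mathcal{K}$ (a product of $m$ exponential cones) and $\mathcal{L}+\mathbf{a}$ satisfy SANE if there exist a chain of faces $\mathcal{F}_\ell\subsetneq\cdots\subsetneq\mathcal{F}_1=\mathcal{K}$ with $\ell-1=d_{\mathrm{PPS}}(\mathcal{K},\mathcal{L}+\mathbf{a})$ satisfying (iii), and vectors $\mathbf{z}_i\in\mathcal{F}_i^*\cap\mathcal{L}^\perp\cap\{\mathbf{a}\}^\perp$ with $\mathcal{F}_{i+1}=\mathcal{F}_i\cap\{\mathbf{z}_i\}^\perp$ for $i=1,\dots,\ell-1$, such that for all $i$ the face $\mathcal{F}_\infty$ of $K_{\exp}$ never appears as one of the blocks of $\mathcal{F}_i$. Uniform Hölderian error bound with exponent $\gamma\in(0,1]$ for convex sets $C_1,C_2$ with nonempty intersection: for every bounded set $B$ there is $\kappa_B>0$ with $\mathrm{d}(\mathbf{x},C_1\cap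 C_2)\le\kappa_B\max\{\mathrm{d}(\mathbf{x},C_1),\mathrm{d}(\mathbf{x},C_2)\}^\gamma$ for all $\mathbf{x}\in B$. *)

(* Defs.v *)
From mathcomp Require Import all_boot all_order all_algebra.
From mathcomp Require Import all_classical all_reals all_analysis.
Set Implicit Arguments.
Unset Strict Implicit.
Unset Printing Implicit Defensive.
Import Order.TTheory GRing.Theory Num.Theory.
Import numFieldNormedType.Exports.
Local Open Scope classical_set_scope.
Local Open Scope ring_scope.

(* Euclidean spaces are matrix spaces with the entrywise inner product: R^n is
   'rV[R]_n and (R^3)^m is 'M[R]_(m, 3), whose i-th row is the i-th block.  The
   library norm on matrices is the sup norm, so the Euclidean norm is defined
   here; the topology (hence [closed]) is the same for both. *)

Section Euclidean.
Context {R : realType} {p q : nat}.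
Implicit Types (x y a : 'M[R]_(p, q)) (C S V F : set 'M[R]_(p, q)).

Definition dot x y : R := \sum_(i < p) \sum_(j < q) x i j * y i j.

Definition enorm x : R := Num.sqrt (dot x x).

Definition dist x C : R := inf [set enorm (x - y) | y in C].

Definition ebounded C : Prop := exists M : R, forall x, C x -> enorm x <= M.

Definition affine (L : {vspace 'M[R]_(p, q)}) a : set 'M[R]_(p, q) :=
  [set l + a | l in [set` L]].

Definition affine_hull C : set 'M[R]_(p, q) :=
  [set x | forall L a, C `<=` affine L a -> affine L a x].

Definition ri C : set 'M[R]_(p, q) :=
  [set x | C x /\ exists2 e : R, 0 < e &
    forall y, affine_hull C y -> enorm (y - x) < e -> C y].

Definition orthogonal_compl S : set 'M[R]_(p, q) :=
  [set z | forall x, S x -> dot x z = 0].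

Definition dual_cone C : set 'M[R]_(p, q) :=
  [set z | forall x, C x -> 0 <= dot x z].

Definition convex_cone C : Prop :=
  [/\ C !=set0, convex_set C & forall (t : R) x, 0 <= t -> C x -> C (t *: x)].

Definition polyhedral C : Prop :=
  exists (k : nat) (A : 'I_k -> 'M[R]_(p, q)) (b : 'I_k -> R),
    C = [set x | forall i, dot (A i) x <= b i].

Definition face C F : Prop :=
  [/\ closed F, convex_cone F, F `<=` C &
      forall x y, C x -> C y -> F (x + y) -> F x /\ F y].

Definition unif_holder (C1 C2 : set 'M[R]_(p, q)) (gamma : R) : Prop :=
  [/\ convex_set C1, convex_set C2, C1 `&` C2 !=set0, 0 < gamma <= 1 &
    forall B, ebounded B -> exists2 kappa : R, 0 < kappa &
      forall x, B x -> dist x (C1 `&` C2) <=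
        kappa * (Num.max (dist x C1) (dist x C2)) `^ gamma].

End Euclidean.

Section PPS.
Context {R : realType} {p q : nat}.
Implicit Types (C V : set 'M[R]_(p, q)).

(* The product C1 x C2 of C1 in R^n1 and C2 in R^n2, placed in 'M[R]_(p, q) by
   the identification s of the n1 + n2 coordinates with the matrix entries;
   letting s be any bijection accounts for the reordering of factors. *)
Definition dprod_set (n1 n2 : nat) (s : 'I_n1 + 'I_n2 -> 'I_p * 'I_q)
    (C1 : set 'rV[R]_n1) (C2 : set 'rV[R]_n2) : set 'M[R]_(p, q) :=
  [set x | C1 (\row_i x (s (inl i)).1 (s (inl i)).2) /\
           C2 (\row_i x (s (inr i)).1 (s (inr i)).2)].

Definition PPS C V : Prop :=
  [\/ V `&` ri C !=set0,
      V `&` C !=set0 /\ polyhedral C |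
      exists (n1 n2 : nat) (s : 'I_n1 + 'I_n2 -> 'I_p * 'I_q)
             (C1 : set 'rV[R]_n1) (C2 : set 'rV[R]_n2),
        [/\ bijective s, convex_cone C1 /\ convex_cone C2,
            C = dprod_set s C1 C2, polyhedral C1 &
            V `&` dprod_set s C1 (ri C2) !=set0]].

(* Chains are indexed from 0: F 0 is the whole cone, and a chain
   F d `<` ... `<` F 0 has length d + 1; F is irrelevant beyond d. *)
Definition face_chain C (d : nat) (F : nat -> set 'M[R]_(p, q)) : Prop :=
  [/\ F 0%N = C, forall i, (i <= d)%N -> face C (F i) &
      forall i, (i < d)%N -> F i.+1 `<` F i].

Definition PPS_chain C V (d : nat) (F : nat -> set 'M[R]_(p, q)) : Prop :=
  [/\ face_chain C d F, F d `&` V = C `&` V & PPS (F d) V].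

(* [is_dPPS C V d]: d is the distance to the PPS condition.  This is a relation
   so that the existence of a chain is never presupposed. *)
Definition is_dPPS C V (d : nat) : Prop :=
  (exists F, PPS_chain C V d F) /\
  (forall d' F, PPS_chain C V d' F -> (d <= d')%N).

End PPS.

Section ExponentialCone.
Context {R : realType}.

Definition K_exp : set 'rV[R]_3 :=
  [set v | let x := v 0 0 in let y := v 0 1 in let z := v 0 2 in
     (0 < y /\ y * expR (x / y) <= z) \/ [/\ x <= 0, 0 <= z & y = 0]].

Definition F_infty : set 'rV[R]_3 :=
  [set v | [/\ v 0 0 <= 0, v 0 1 = 0 & v 0 2 = 0]].

Context {m : nat}.
Implicit Types (L : {vspace 'M[R]_(m, 3)}) (a : 'M[R]_(m, 3)).

Definition K_exp_prod : set 'M[R]_(m, 3) :=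
  [set x | forall i : 'I_m, K_exp (row i x)].

(* The i-th factor of a nonempty product set is its i-th projection. *)
Definition block (F : set 'M[R]_(m, 3)) (i : 'I_m) : set 'rV[R]_3 :=
  [set row i x | x in F].

Definition SANE L a : Prop :=
  exists (d : nat) (F : nat -> set 'M[R]_(m, 3)) (z : nat -> 'M[R]_(m, 3)),
    [/\ is_dPPS K_exp_prod (affine L a) d,
        PPS_chain K_exp_prod (affine L a) d F,
        forall i, (i < d)%N ->
          [/\ dual_cone (F i) (z i), orthogonal_compl [set` L] (z i) &
              orthogonal_compl [set a] (z i)],
        forall i, (i < d)%N -> F i.+1 = F i `&` orthogonal_compl [set z i] &
        forall i, (i <= d)%N -> forall j : 'I_m, block (F i) j <> F_infty].

End ExponentialCone.
Arguments K_exp_prod : clear implicits.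

(* Main.v *)
(* Part 1.  Averaging feasible points gives one that is interior in every block
   where some feasible point is interior.  In each remaining block the feasible
   points form a convex subset of the boundary of [K_exp], hence lie in a single
   exposed, polyhedral face; cutting these blocks one after the other yields a
   chain of at most [m] proper inclusions whose last face satisfies the third
   case of PPS.

   Part 2.  Let [e] bound the distances from a point [x] to the cone and to the
   affine space.  The exposing vector [z_i] is constant on the affine space, so
   a point of [F_i] at distance [O(s ^ 2)] from [x] has [<., z_i> = O(s ^ 2)];
   away from the exceptional face, this puts it at distance [O(s)] from
   [F_(i + 1)].  After [d] steps [x] is within [O(e ^ (2 ^- d))] of [F_d], and
   PPS makes [F_d] and the affine space boundedly linearly regular (Hoffman's
   bound for the polyhedral part, a segment to a Slater point for the rest). *)
Require Import Defs.
From HB Require Import structures.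
From mathcomp Require Import all_boot all_order all_algebra.
From mathcomp Require Import all_classical all_reals all_analysis.
From mathcomp Require Import ring lra.
Set Implicit Arguments.
Unset Strict Implicit.
Unset Printing Implicit Defensive.
Import Order.TTheory GRing.Theory Num.Theory.
Import numFieldNormedType.Exports.
Local Open Scope classical_set_scope.
Local Open Scope ring_scope.

(** The square root lost per step is the second-order contact of [exp] with its tangents: a
    functional exposing a nonzero ray other than [F_infty] grows only quadratically off that ray,
    because exp s - 1 - s >= s^2 / 4 for s >= -2. For [F_infty] no power suffices: under the
    functional (0, 0, w) with w > 0 the points (-1, y, y exp (-1/y)) have product w y exp (-1/y),
    yet lie at distance at least y from the face.

    A block that has been cut is kept as a finitely generated cone rather than as a polyhedron,
    since both the next cut and its residual can be read off the generators; such residuals are even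
    linear in the product.

    No separation theorem is used. [K_exp] is cut out by y >= 0, z >= 0 and the explicit tangents of
    slope r, and these inequalities supply the bidual and all supporting functionals.

    Distances are infima that need not be attained, so every intermediate estimate speaks of
    explicit nearby points; [dist] enters only at the end, through a strict inequality. *)

Section EuclideanLemmas.
Context {R : realType} {p q : nat}.
Implicit Types (x y z : 'M[R]_(p, q)) (t : R).

Lemma dotC x y : dot x y = dot y x.
Proof. by apply: eq_bigr => i _; apply: eq_bigr => j _; rewrite mulrC. Qed.

Lemma dotDl x y z : dot (x + y) z = dot x z + dot y z.
Proof.
rewrite /dot -big_split; apply: eq_bigr => i _ /=.
by rewrite -big_split; apply: eq_bigr => j _; rewrite /= mxE mulrDl.
Qed.

Lemma dotZl t x z : dot (t *: x) z = t * dot x z.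
Proof.
rewrite /dot mulr_sumr; apply: eq_bigr => i _ /=.
by rewrite mulr_sumr; apply: eq_bigr => j _; rewrite /= mxE mulrA.
Qed.

Lemma dotDr x y z : dot z (x + y) = dot z x + dot z y.
Proof. by rewrite !(dotC z) dotDl. Qed.

Lemma dotZr t x z : dot z (t *: x) = t * dot z x.
Proof. by rewrite !(dotC z) dotZl. Qed.

Lemma dotNl x z : dot (- x) z = - dot x z.
Proof. by rewrite -scaleN1r dotZl mulN1r. Qed.

Lemma dotNr x z : dot z (- x) = - dot z x.
Proof. by rewrite !(dotC z) dotNl. Qed.

Lemma dotBl x y z : dot (x - y) z = dot x z - dot y z.
Proof. by rewrite dotDl dotNl. Qed.

Lemma dotBr x y z : dot z (x - y) = dot z x - dot z y.
Proof. by rewrite dotDr dotNr. Qed.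

Lemma dot0l z : dot 0 z = 0.
Proof. by rewrite -(scale0r 0) dotZl mul0r. Qed.

Lemma dot0r z : dot z 0 = 0.
Proof. by rewrite dotC dot0l. Qed.

Lemma dot_suml (I : Type) (s : seq I) (P : pred I) (F : I -> 'M[R]_(p, q)) z :
  dot (\sum_(i <- s | P i) F i) z = \sum_(i <- s | P i) dot (F i) z.
Proof.
by apply: (big_morph (fun x => dot x z)); [move=> x y; rewrite dotDl|rewrite dot0l].
Qed.

Lemma dot_deltal i j z : dot (delta_mx i j) z = z i j.
Proof.
rewrite /dot (bigD1 i) //= [X in _ + X]big1 ?addr0.
  rewrite (bigD1 j) //= big1 ?addr0; first by rewrite mxE !eqxx mul1r.
  by move=> k kj; rewrite mxE (negbTE kj) andbF mul0r.
move=> k ki; rewrite big1 // => l _.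
by rewrite mxE (negbTE ki) mul0r.
Qed.

Lemma dot_ge0 x : 0 <= dot x x.
Proof. by apply: sumr_ge0 => i _; apply: sumr_ge0 => j _; rewrite -expr2 sqr_ge0. Qed.

Lemma dot_entry x i j : x i j ^+ 2 <= dot x x.
Proof.
rewrite /dot (bigD1 i) //= (bigD1 j) //= -expr2 -addrA lerDl addr_ge0 //.
  by apply: sumr_ge0 => k _; rewrite -expr2 sqr_ge0.
by apply: sumr_ge0 => k _; apply: sumr_ge0 => l _; rewrite -expr2 sqr_ge0.
Qed.

Lemma enorm_ge0 x : 0 <= enorm x.
Proof. exact: sqrtr_ge0. Qed.

Lemma enorm_sqr x : enorm x ^+ 2 = dot x x.
Proof. by rewrite sqr_sqrtr ?dot_ge0. Qed.

Lemma enorm_entry x i j : `|x i j| <= enorm x.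
Proof. by rewrite -sqrtr_sqr ler_wsqrtr // dot_entry. Qed.

(** Cauchy-Schwarz: for [y] nonzero, expand the squared norm of [dot y y *: x - dot x y *: y] and
    cancel the factor [dot y y]. *)
Lemma dot_le x y : dot x y <= enorm x * enorm y.
Proof.
have [y0|yn0] := eqVneq (dot y y) 0.
  have -> : y = 0.
    apply/matrixP => i j; rewrite mxE; apply/eqP.
    by have := dot_entry y i j; rewrite y0 real_exprn_even_le0 ?num_real.
  by rewrite dot0r mulr_ge0 ?enorm_ge0.
have ypos : 0 < dot y y by rewrite lt_neqAle eq_sym yn0 dot_ge0.
have H : dot x y ^+ 2 <= dot x x * dot y y.
  have := dot_ge0 (dot y y *: x - dot x y *: y).
  rewrite !dotBl !dotBr !dotZl !dotZr (dotC y x).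
  set A := dot x x; set B := dot x y; set D := dot y y => h.
  have {}h : 0 <= D * (A * D - B ^+ 2).
    by apply: le_trans h _; rewrite le_eqVlt; apply/orP; left; apply/eqP; ring.
  by rewrite -subr_ge0 -(pmulr_rge0 _ ypos).
apply: le_trans (ler_norm _) _; rewrite -sqrtr_sqr -sqrtrM ?dot_ge0 //.
exact: ler_wsqrtr.
Qed.

Lemma ler_enormD x y : enorm (x + y) <= enorm x + enorm y.
Proof.
rewrite -(@ler_pXn2r _ 2) ?nnegrE ?addr_ge0 ?enorm_ge0 //.
rewrite enorm_sqr sqrrD !enorm_sqr dotDl !dotDr (dotC y x).
by have := dot_le x y; lra.
Qed.

Lemma enormZ t x : enorm (t *: x) = `|t| * enorm x.
Proof.
by rewrite /enorm dotZl dotZr mulrA -expr2 sqrtrM ?sqr_ge0 // sqrtr_sqr.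
Qed.

Lemma enormN x : enorm (- x) = enorm x.
Proof. by rewrite -scaleN1r enormZ normrN1 mul1r. Qed.

Lemma enorm0 : enorm (0 : 'M[R]_(p, q)) = 0.
Proof. by rewrite -(scale0r 0) enormZ normr0 mul0r. Qed.

Lemma enorm_distC x y : enorm (x - y) = enorm (y - x).
Proof. by rewrite -enormN opprB. Qed.

Lemma ler_enorm_distD z x y : enorm (x - y) <= enorm (x - z) + enorm (z - y).
Proof. by apply: le_trans (ler_enormD _ _); rewrite addrA subrK. Qed.

Lemma ler_enorm_sum (I : Type) (s : seq I) (P : pred I) (F : I -> 'M[R]_(p, q)) :
  enorm (\sum_(i <- s | P i) F i) <= \sum_(i <- s | P i) enorm (F i).
Proof.
elim/big_rec2: _ => [|i a b _ h]; first by rewrite enorm0.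
by apply: le_trans (ler_enormD _ _) _; rewrite lerD2l.
Qed.

Lemma enorm_delta i j : enorm (delta_mx i j : 'M[R]_(p, q)) = 1.
Proof. by rewrite /enorm dot_deltal mxE !eqxx sqrtr1. Qed.

Lemma enorm_le_sum x : enorm x <= \sum_i \sum_j `|x i j|.
Proof.
rewrite {1}[x]matrix_sum_delta; apply: le_trans (ler_enorm_sum _ _ _) _.
apply: ler_sum => i _; apply: le_trans (ler_enorm_sum _ _ _) _.
by apply: ler_sum => j _; rewrite enormZ enorm_delta mulr1.
Qed.

End EuclideanLemmas.

(** * Hoffman's error bound for finite systems of linear inequalities *)

Section Hoffman.
Context {R : realType} {p q : nat}.
Notation constraint := ('M[R]_(p, q) * R)%type.
Implicit Types (x y z : 'M[R]_(p, q)) (t : R) (cs : seq constraint).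

Definition solves cs x (e : R) := forall c, c \in cs -> dot c.1 x <= c.2 + e.

(** The list [s] holds the entries still to be eliminated and carries the induction of [hoffman]. *)
Definition supported (s : seq ('I_p * 'I_q)) cs :=
  forall c, c \in cs -> forall i j, (i, j) \notin s -> c.1 i j = 0.

(** The clamping step: [t] is the maximum of [- T] and the elements of [lo], so it exceeds no upper
    bound and stays within [T]. *)
Lemma exists_between (lo hi : seq R) (T : R) : 0 <= T ->
  (forall l h, l \in lo -> h \in hi -> l <= h) ->
  (forall l, l \in lo -> l <= T) -> (forall h, h \in hi -> - T <= h) ->
  exists t, [/\ `|t| <= T, forall l, l \in lo -> l <= t &
                forall h, h \in hi -> t <= h].
Proof.
move=> T0 lohi loT hiT; have TT : - T <= T by rewrite ge0_cp.
elim: lo lohi loT => [|a lo IH] lohi loT.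
  by exists (- T); split => //; rewrite normrN ger0_norm.
have [||t [tT lot thi]] := IH.
- by move=> l h llo; apply: lohi; rewrite inE llo orbT.
- by move=> l llo; apply: loT; rewrite inE llo orbT.
have aT : a <= T by apply: loT; rewrite mem_head.
exists (Num.max a t); split.
- move: tT; rewrite !ler_norml => /andP[t1 t2].
  by rewrite le_max t1 orbT ge_max aT t2.
- by move=> l; rewrite inE le_max => /predU1P[->|/lot ->]; rewrite ?lexx ?orbT.
- move=> h hh; rewrite ge_max thi // andbT; apply: lohi => //.
  exact: mem_head.
Qed.

Definition scale_constraint (a : R) (c : constraint) : constraint :=
  (a *: c.1, a * c.2).

Lemma sum_bound (I : eqType) (s : seq I) (F : I -> R) :
  (forall i, 0 <= F i) -> forall i, i \in s -> F i <= \sum_(j <- s) F j.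
Proof.
move=> F0 i; elim: s => // a s IH; rewrite inE big_cons => /predU1P[->|/IH h].
  by rewrite lerDl sumr_ge0.
by apply: le_trans h _; rewrite lerDr.
Qed.

(* Fourier--Motzkin elimination: eliminating one entry pairs the constraints
   bounding it from above with those bounding it from below, and a nearby
   solution of the eliminated system is lifted by clamping that entry. *)
Lemma hoffman (s : seq ('I_p * 'I_q)) cs :
  supported s cs -> (exists x, solves cs x 0) ->
  exists2 k : R, 0 <= k & forall x e, 0 <= e -> solves cs x e ->
    exists2 y, solves cs y 0 & enorm (x - y) <= k * e.
Proof.
elim: s cs => [|[i j] s IH] cs sup [x0 x0P].
  (* With no entry left all normals vanish, so feasibility of one point makes every point a
     solution. *)
  have cs0 c : c \in cs -> c.1 = 0.
    by move=> /sup h; apply/matrixP => i j; rewrite h // mxE.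
  exists 0 => // x e e0 _; exists x; last by rewrite subrr enorm0 mul0r.
  by move=> c ccs; have := x0P c ccs; rewrite !cs0 // !dot0l.
pose al (c : constraint) := c.1 i j.
(* Normalisation makes the coefficient of the eliminated entry 1 on [U] and -1 on [W], so that it
   cancels in each sum taken in [cs']. *)
pose nc c := scale_constraint `|al c|^-1 c.
pose U := [seq nc c | c <- cs & 0 < al c].
pose W := [seq nc c | c <- cs & al c < 0].
pose Z := [seq c <- cs | al c == 0].
pose cs' := Z ++ [seq (u.1 + l.1, u.2 + l.2) | u <- U, l <- W].
pose N := \sum_(c <- cs) `|al c|^-1.
pose M := \sum_(c <- cs) enorm (nc c).1.
have N0 : 0 <= N by apply: sumr_ge0 => c _; rewrite invr_ge0.
have M0 : 0 <= M by apply: sumr_ge0 => c _; exact: enorm_ge0.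
have NP c : c \in cs -> `|al c|^-1 <= N.
  by move=> ccs; apply: (sum_bound (F := fun c => `|al c|^-1)) => // ?; rewrite invr_ge0.
have MP c : c \in cs -> enorm (nc c).1 <= M.
  move=> ccs; apply: (sum_bound (F := fun c => enorm (nc c).1)) => // ?.
  exact: enorm_ge0.
have ncP x e c : 0 <= e -> solves cs x e -> c \in cs ->
    dot (nc c).1 x <= (nc c).2 + N * e.
  move=> e0 xs ccs; rewrite /= dotZl.
  have h : 0 <= `|al c|^-1 by rewrite invr_ge0.
  apply: le_trans (ler_wpM2l h (xs c ccs)) _.
  by rewrite mulrDr lerD2l ler_wpM2r // NP.
(* A normalised constraint is violated by at most [N * e], hence a pair by [2 * N * e]; the extra 1
   covers the constraints of [Z], kept as they are. *)
have cs'P x e : 0 <= e -> solves cs x e -> solves cs' x ((2 * N + 1) * e).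
  move=> e0 xs c; rewrite mem_cat => /orP[|/allpairsP[[u l] /= [uU lW ->]]].
    rewrite /Z mem_filter => /andP[_ ccs]; apply: le_trans (xs c ccs) _.
    by rewrite lerD2l mulrDl mul1r lerDr mulr_ge0 // mulr_ge0.
  have /mapP[u' + ->] := uU; rewrite mem_filter => /andP[_ /(ncP _ _ _ e0 xs) hu].
  have /mapP[l' + ->] := lW; rewrite mem_filter => /andP[_ /(ncP _ _ _ e0 xs) hl].
  by move: hu hl; rewrite /= dotDl; lra.
have [] := IH cs'.
- move=> c; rewrite mem_cat => /orP[cZ|/allpairsP[[u l] /= [uU lW ->]]] i' j' ijs.
    move: cZ; rewrite mem_filter => /andP[/eqP c0 ccs].
    have [[-> ->] //|ne] := eqVneq (i', j') (i, j).
    by apply: sup => //; rewrite inE negb_or ne.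
  have /mapP[u' + ->] := uU; rewrite mem_filter => /andP[u0 ucs].
  have /mapP[l' + ->] := lW; rewrite mem_filter => /andP[l0 lcs].
  rewrite /= !mxE; have [[-> ->]|ne] := eqVneq (i', j') (i, j).
    rewrite gtr0_norm // ltr0_norm // invrN mulNr -/(al u') -/(al l').
    by rewrite mulVf ?gt_eqF // mulVf ?lt_eqF // subrr.
  by rewrite !sup ?mulr0 ?addr0 // inE negb_or ne.
- by exists x0; have := cs'P x0 0 (lexx _) x0P; rewrite mulr0.
move=> k k0 kP.
(* [T * e] bounds the violation at [y] of a normalised constraint: [N * e] at [x], plus the norm [M]
   of a normal times the distance from [x] to [y]. *)
pose T := N + M * (k * (2 * N + 1)).
have T0 : 0 <= T by rewrite addr_ge0 // !mulr_ge0 // addr_ge0 // mulr_ge0.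
exists (k * (2 * N + 1) + T).
  by rewrite addr_ge0 // mulr_ge0 // addr_ge0 // mulr_ge0.
move=> x e e0 xs.
have e'0 : 0 <= (2 * N + 1) * e by rewrite mulr_ge0 // addr_ge0 // mulr_ge0.
have [y ys xy] := kP x _ e'0 (cs'P x e e0 xs).
have slack c : c \in cs -> - (T * e) <= (nc c).2 - dot (nc c).1 y.
  move=> ccs; have h1 := ncP x e c e0 xs ccs.
  have h2 := dot_le (nc c).1 (y - x).
  have h3 : enorm (nc c).1 * enorm (y - x) <= M * (k * ((2 * N + 1) * e)).
    by rewrite ler_pM ?enorm_ge0 ?MP // enorm_distC.
  rewrite /T; move: h1 h2 h3; rewrite dotBr; nra.
have [||| |t [tT lot thi]] := @exists_between
   [seq dot l.1 y - l.2 | l <- W] [seq u.2 - dot u.1 y | u <- U] (T * e).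
- exact: mulr_ge0.
- move=> _ _ /mapP[l lW ->] /mapP[u uU ->].
  have /ys : (u.1 + l.1, u.2 + l.2) \in cs'.
    by rewrite mem_cat; apply/orP; right; apply/allpairsP; exists (u, l).
  by rewrite /= dotDl; lra.
- move=> _ /mapP[_ /mapP[c + ->] ->]; rewrite mem_filter => /andP[_ /slack].
  by lra.
- move=> _ /mapP[_ /mapP[c + ->] ->]; rewrite mem_filter => /andP[_ /slack].
  by lra.
exists (y + t *: delta_mx i j).
  move=> c ccs; rewrite addr0 dotDr dotZr (dotC c.1 (delta_mx _ _)) dot_deltal.
  rewrite -/(al c); have [c0|c0|c0] := ltgtP (al c) 0.
  - have : dot (nc c).1 y - (nc c).2 <= t.
      by apply/lot/map_f/map_f; rewrite mem_filter c0.
    by rewrite /= dotZl -mulrBr ler_pdivrMl ?normr_gt0 ?lt_eqF // ltr0_norm //; lra.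
  - have : t <= (nc c).2 - dot (nc c).1 y.
      by apply/thi/map_f/map_f; rewrite mem_filter c0.
    by rewrite /= dotZl -mulrBr ler_pdivlMl ?normr_gt0 ?gt_eqF // gtr0_norm //; lra.
  - have := ys c; rewrite mem_cat mem_filter c0 eqxx ccs => /(_ isT).
    by rewrite mulr0 !addr0.
rewrite opprD addrA; apply: le_trans (ler_enormD _ _) _.
rewrite enormN enormZ enorm_delta mulr1 mulrDl lerD //.
by rewrite -mulrA.
Qed.

End Hoffman.

(** * Convex cones, affine spaces and affine hulls *)

Section Sets.
Context {R : realType} {p q : nat}.
Implicit Types (x y z : 'M[R]_(p, q)) (t : R) (C D : set 'M[R]_(p, q)).

Lemma convex_setP C : convex_set C <->
  (forall x y t, 0 <= t <= 1 -> C x -> C y -> C (t *: x + (1 - t) *: y)).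
Proof.
split=> [h x y t t01 /mem_set Cx /mem_set Cy|h x y t /set_mem Cx /set_mem Cy].
  exact: set_mem (h x y (Itv01 (andP t01).1 (andP t01).2) Cx Cy).
by apply/mem_set/h => //; rewrite ge0 le1.
Qed.

Lemma convex_coneD C x y : convex_cone C -> C x -> C y -> C (x + y).
Proof.
move=> [_ /convex_setP cC sC] Cx Cy.
have -> : x + y = 2 *: (2^-1 *: x + (1 - 2^-1) *: y).
  rewrite scalerDr !scalerA mulfV ?pnatr_eq0 // scale1r.
  by rewrite [X in X *: y](_ : _ = 1) ?scale1r //; field.
by apply: sC => //; apply: cC => //; lra.
Qed.

Lemma affineP (L : {vspace 'M[R]_(p, q)}) a x : affine L a x <-> x - a \in L.
Proof.
split=> [[l /= lL <-]|h]; first by rewrite addrK.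
by exists (x - a); rewrite //= subrK.
Qed.

Lemma affine_rebase (L : {vspace 'M[R]_(p, q)}) a c :
  affine L a c -> affine L a = affine L c.
Proof.
move=> /affineP h; apply/seteqP; split=> x /affineP hx; apply/affineP.
  by rewrite -(subrKA a) memvD // -opprB memvN.
by rewrite -(subrKA c) memvD.
Qed.

(** For a nonempty set this means being an affine subspace; naming no direction space lets the
    property pass directly to preimages under linear maps. *)
Definition flat C :=
  forall x y z t, C x -> C y -> C z -> C (x + t *: (y - z)).

Lemma affine_flat (L : {vspace 'M[R]_(p, q)}) a : flat (affine L a).
Proof.
move=> x y z t /affineP hx /affineP hy /affineP hz; apply/affineP.
rewrite addrAC memvD // memvZ // -(subrKA a) memvD // -opprB memvN //.
Qed.

Lemma affine_convex (L : {vspace 'M[R]_(p, q)}) a : convex_set (affine L a).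
Proof.
apply/convex_setP => x y t _ hx hy.
have -> : t *: x + (1 - t) *: y = y + t *: (x - y).
  by rewrite scalerBl scale1r scalerBr addrCA.
exact: affine_flat.
Qed.

(** Take a direction space of least dimension covering [C] from [c]: its intersection with any
    competitor still covers [C], so by minimality it is contained in the competitor. *)
Lemma affine_hullE C : C !=set0 -> exists L a, affine_hull C = affine L a.
Proof.
move=> [c Cc].
pose P n := `[< exists2 L : {vspace 'M[R]_(p, q)}, \dim L = n & C `<=` affine L c >].
have exP : exists n, P n.
  exists (\dim {:'M[R]_(p, q)}); apply/asboolP; exists fullv => // x _.
  by apply/affineP; rewrite memvf.
case: (ex_minnP exP) => n /asboolP[L Ln CL] minL; exists L, c.
apply/seteqP; split=> [x|x Lx L' a CL']; first exact.
rewrite (affine_rebase (CL' c Cc)).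
suff LL' : (L <= L')%VS.
  by apply/affineP/(subvP LL'); apply/affineP.
have : (n <= \dim (L :&: L'))%N.
  apply: minL; apply/asboolP; exists (L :&: L')%VS => // y Cy; apply/affineP.
  rewrite memv_cap; move/affineP: (CL y Cy) => ->.
  by move: (CL' y Cy); rewrite (affine_rebase (CL' c Cc)) => /affineP ->.
rewrite -Ln => h; have /eqP <- : (L :&: L' == L)%VS; last exact: capvSr.
by rewrite eqEdim capvSl.
Qed.

Lemma sub_affine_hull C : C `<=` affine_hull C.
Proof. by move=> x Cx L a; apply. Qed.

End Sets.

(** * Polyhedral sets and their linear regularity *)

Section Polyhedral.
Context {R : realType}.

(** The matrix on the right is the adjoint of [f] applied to [A]; it pulls linear constraints back
    along [f]. *)
Lemma adjointE p q p' q' (f : 'M[R]_(p, q) -> 'M[R]_(p', q')) (A : 'M[R]_(p', q')) :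
  linear f -> forall x, dot A (f x) = dot (\matrix_(i, j) dot A (f (delta_mx i j))) x.
Proof.
move=> lf x.
pose F : {linear 'M[R]_(p, q) -> 'M[R]_(p', q')} :=
  HB.pack f (GRing.isLinear.Build _ _ _ _ f lf).
rewrite -[f]/(F : _ -> _) {1}[x]matrix_sum_delta linear_sum dotC dot_suml.
apply: eq_bigr => i _; rewrite linear_sum dot_suml; apply: eq_bigr => j _.
by rewrite linearZ dotZl mxE mulrC dotC.
Qed.

Lemma linear_bounded p q p' q' (f : 'M[R]_(p, q) -> 'M[R]_(p', q')) :
  linear f -> exists2 k : R, 0 < k & forall x, enorm (f x) <= k * enorm x.
Proof.
move=> lf.
pose F : {linear 'M[R]_(p, q) -> 'M[R]_(p', q')} :=
  HB.pack f (GRing.isLinear.Build _ _ _ _ f lf).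
pose k : R := \sum_(i < p) \sum_(j < q) enorm (f (delta_mx i j)).
have k0 : 0 <= k by do 2!apply: sumr_ge0 => ? _; exact: enorm_ge0.
exists (k + 1) => [|x]; first by rewrite ltr_wpDl.
apply: (@le_trans _ _ (k * enorm x)); last by rewrite ler_wpM2r ?enorm_ge0 ?lerDl.
rewrite -[f]/(F : _ -> _) {1}[x]matrix_sum_delta linear_sum mulr_suml.
apply: le_trans (ler_enorm_sum _ _ _) _; apply: ler_sum => i _.
rewrite linear_sum mulr_suml.
apply: le_trans (ler_enorm_sum _ _ _) _; apply: ler_sum => j _.
by rewrite linearZ enormZ mulrC ler_wpM2l ?enorm_ge0 ?enorm_entry.
Qed.

Context {p q : nat}.
Implicit Types (x y z : 'M[R]_(p, q)) (t : R) (C D : set 'M[R]_(p, q)).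

Lemma polyhedralP C :
  polyhedral C <-> exists cs : seq ('M[R]_(p, q) * R), C = [set x | solves cs x 0].
Proof.
split=> [[k [A [b ->]]]|[cs ->]].
  exists [seq (A i, b i) | i <- enum 'I_k]; apply/seteqP; split=> x /= h.
    by move=> _ /mapP[i _ ->]; rewrite addr0 h.
  by move=> i; have /h := map_f (fun i => (A i, b i)) (mem_enum 'I_k i); rewrite addr0.
exists (size cs), (fun i => (nth (0, 0) cs i).1), (fun i => (nth (0, 0) cs i).2).
apply/seteqP; split=> x /= h; first by move=> i; rewrite -[_.2]addr0 h ?mem_nth.
move=> c /(nthP (0, 0))[i ics <-]; rewrite addr0; exact: (h (Ordinal ics)).
Qed.

Lemma polyhedralI C D : polyhedral C -> polyhedral D -> polyhedral (C `&` D).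
Proof.
move=> /polyhedralP[cs ->] /polyhedralP[ds ->]; apply/polyhedralP.
exists (cs ++ ds); apply/seteqP; split=> x /=.
  by move=> [h1 h2] c; rewrite mem_cat => /orP[]; [exact: h1|exact: h2].
by move=> h; split=> c cc; apply: h; rewrite mem_cat cc ?orbT.
Qed.

Lemma polyhedralT : polyhedral [set: 'M[R]_(p, q)].
Proof. by apply/polyhedralP; exists [::]; apply/seteqP; split. Qed.

Lemma polyhedral_le (a : 'M[R]_(p, q)) b : polyhedral [set x | dot a x <= b].
Proof.
apply/polyhedralP; exists [:: (a, b)]; apply/seteqP; split=> x /= h.
  by move=> c; rewrite inE => /eqP ->; rewrite addr0.
by have := h _ (mem_head _ _); rewrite addr0.
Qed.

Lemma polyhedral_eq (a : 'M[R]_(p, q)) b : polyhedral [set x | dot a x = b].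
Proof.
rewrite (_ : mkset _ = [set x | dot a x <= b] `&` [set x | dot (- a) x <= - b]).
  by apply: polyhedralI; exact: polyhedral_le.
apply/seteqP; split=> x /=; first by rewrite dotNl => ->.
by rewrite dotNl lerN2 => -[h1 h2]; apply/eqP; rewrite eq_le h1.
Qed.

Lemma polyhedral_bigcap (I : finType) (C : I -> set 'M[R]_(p, q)) :
  (forall i, polyhedral (C i)) -> polyhedral [set x | forall i, C i x].
Proof.
move=> h; rewrite (_ : mkset _ = [set x | forall i, i \in enum I -> C i x]).
  elim: (enum I) => [|i s IH].
    by rewrite (_ : mkset _ = setT); [exact: polyhedralT|apply/seteqP; split].
  rewrite (_ : mkset _ = C i `&` [set x | forall j, j \in s -> C j x]).
    exact: polyhedralI.
  apply/seteqP; split=> x /= Cx.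
    by split=> [|j js]; apply: Cx; rewrite inE ?eqxx ?js ?orbT.
  by case: Cx => Ci Cs j; rewrite inE => /predU1P[->//|]; exact: Cs.
by apply/seteqP; split=> x Cx i; [move=> _; exact: Cx|apply: Cx; rewrite mem_enum].
Qed.

Lemma polyhedral_preimage p' q' (f : 'M[R]_(p, q) -> 'M[R]_(p', q')) (C : set 'M[R]_(p', q')) :
  linear f -> polyhedral C -> polyhedral [set x | C (f x)].
Proof.
move=> lf [k [A [b ->]]].
exists k, (fun l => \matrix_(i, j) dot (A l) (f (delta_mx i j))), b.
by apply/seteqP; split=> x /= h i; have := h i; rewrite -adjointE.
Qed.

Lemma polyhedral_affine (L : {vspace 'M[R]_(p, q)}) (a : 'M[R]_(p, q)) :
  polyhedral (affine L a).
Proof.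
(* [f] is linear with kernel [L], so the affine space is described by the entrywise equations
   [f x = f a]. *)
pose f x := x - projv L x.
have lf : linear f.
  by move=> t x y; rewrite /f linearP opprD addrACA scalerBr.
have fB x y : f (x - y) = f x - f y.
  by rewrite -scaleN1r addrC lf scaleN1r addrC.
have fE x : (x \in L) = (f x == 0).
  rewrite /f subr_eq0; apply/idP/eqP => [xL|->]; last exact: memv_proj.
  by rewrite projv_id.
have -> : affine L a = [set x | forall ij : 'I_p * 'I_q,
    [set y | dot (delta_mx ij.1 ij.2) y = f a ij.1 ij.2] (f x)].
  apply/seteqP; split=> x.
    by move=> /affineP; rewrite fE fB subr_eq0 => /eqP h [i j] /=; rewrite dot_deltal h.
  move=> h; apply/affineP; rewrite fE fB subr_eq0; apply/eqP/matrixP => i j.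
  by have := h (i, j); rewrite /= dot_deltal.
apply: polyhedral_bigcap => ij.
apply: (polyhedral_preimage (C := [set y | dot _ y = _])) => //; exact: polyhedral_eq.
Qed.

(** Hoffman's bound for the concatenated system: being within [e] of a solution of a constraint
    means violating it by at most [e] times the norm of its normal, and [M] dominates these
    norms. *)
Lemma polyhedral_regular C D : polyhedral C -> polyhedral D -> C `&` D !=set0 ->
  exists2 k : R, 0 <= k & forall x y z e, C y -> D z ->
    enorm (x - y) <= e -> enorm (x - z) <= e ->
    exists2 w, (C `&` D) w & enorm (x - w) <= k * e.
Proof.
move=> /polyhedralP[cs ->] /polyhedralP[ds ->] [x0 [x0c x0d]].
have [||k k0 kP] := @hoffman R p q (enum {: 'I_p * 'I_q}) (cs ++ ds).
- by move=> c _ i j; rewrite mem_enum.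
- by exists x0 => c; rewrite mem_cat => /orP[/x0c|/x0d].
pose M := \sum_(c <- cs ++ ds) enorm c.1.
have M0 : 0 <= M by apply: sumr_ge0 => c _; exact: enorm_ge0.
exists (k * M) => [|x y z e Cy Dz xy xz]; first exact: mulr_ge0.
have e0 : 0 <= e := le_trans (enorm_ge0 _) xy.
have viol c u : c \in cs ++ ds -> dot c.1 u <= c.2 + 0 -> enorm (x - u) <= e ->
    dot c.1 x <= c.2 + M * e.
  move=> ccs cu xu; rewrite -(subrK u x) dotDr addrC lerD //.
    by rewrite -[c.2]addr0.
  apply: le_trans (dot_le _ _) _; rewrite ler_pM ?enorm_ge0 //.
  by apply: (sum_bound (F := fun c => enorm c.1)) => // ?; exact: enorm_ge0.
have [||w ws xw] := kP x (M * e); first exact: mulr_ge0.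
  move=> c ccs; have := ccs; rewrite mem_cat => /orP[/Cy|/Dz] h.
    exact: viol ccs h xy.
  exact: viol ccs h xz.
exists w; last by rewrite -mulrA.
by split=> c cc; apply: ws; rewrite mem_cat cc ?orbT.
Qed.

End Polyhedral.

(** * Bounded linear regularity under the PPS condition *)

Section Regularity.
Context {R : realType} {p q : nat}.
Implicit Types (x y z : 'M[R]_(p, q)) (t : R) (A C D Q V : set 'M[R]_(p, q)).

(** Linear regularity on the ball of radius [M], stated with witnesses [y], [z], [w] instead of
    distances so that no infimum has to be attained. *)
Definition bounded_regular C V := forall M : R, exists2 k : R, 0 <= k &
  forall x y z e, enorm x <= M -> C y -> V z ->
    enorm (x - y) <= e -> enorm (x - z) <= e ->
    exists2 w, (C `&` V) w & enorm (x - w) <= k * e.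

(* A point [y] of the polyhedral set [Q `&` A `&` V] close to [x] is moved
   towards the Slater point [u] by an amount proportional to its distance to
   [D], which suffices to enter [D]. *)
Lemma slater_regular Q A D V u (r : R) :
  polyhedral Q -> polyhedral A -> polyhedral V -> convex_set D -> flat A ->
  D `<=` A -> Q u -> D u -> V u -> 0 < r ->
  (forall y, A y -> enorm (y - u) < r -> D y) -> bounded_regular (Q `&` D) V.
Proof.
move=> pQ pA pV cD fA DA Qu Du Vu r0 uD M.
have pP : polyhedral (V `&` (Q `&` A)) by do 2!apply: polyhedralI => //.
have cP : convex_set (V `&` (Q `&` A)).
  have [cs ->] := (polyhedralP _).1 pP.
  apply/convex_setP => x y t /andP[t0 t1] xs ys c ccs; rewrite dotDr !dotZr.
  have := xs c ccs; have := ys c ccs; nra.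
have [|k k0 kP] := polyhedral_regular (polyhedralI pQ pA) pV.
  by exists u; do !split => //; exact: DA.
pose N := enorm u + `|M|.
have N0 : 0 <= N by rewrite addr_ge0 ?enorm_ge0.
have kr0 : 0 <= k * r by apply: mulr_ge0 => //; exact: ltW.
have E0 : 0 <= (k + 1) * (2 / r) * (N + k * r).
  apply: mulr_ge0; last exact: addr_ge0.
  by apply: mulr_ge0; [exact: addr_ge0|apply: divr_ge0 => //; exact: ltW].
exists (k + (k + 1) * (2 / r) * (N + k * r)); first exact: addr_ge0.
move=> x c v e xM [Qc Dc] Vv xc xv.
have e0 : 0 <= e := le_trans (enorm_ge0 _) xc.
have [y [[Qy Ay] Vy] xy] := kP x c v e (conj Qc (DA _ Dc)) Vv xc xv.
have yc : enorm (y - c) <= (k + 1) * e.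
  by rewrite (le_trans (ler_enorm_distD x _ _)) // enorm_distC mulrDl mul1r lerD.
(* When [e] is at least the Slater radius, [u] itself is close enough, since [N] bounds its distance
   to [x]. *)
have big : r <= e -> exists2 w, (Q `&` D `&` V) w &
    enorm (x - w) <= (k + (k + 1) * (2 / r) * (N + k * r)) * e.
  move=> re; exists u => //; apply: (@le_trans _ _ N).
    rewrite /N addrC (le_trans (ler_enormD _ _)) // enormN lerD //.
    exact: le_trans xM (ler_norm _).
  have h1 : 1 <= e / r by rewrite ler_pdivlMr ?mul1r.
  have h2 : 0 <= k * e by exact: mulr_ge0.
  have h3 : 0 <= k * r by apply: mulr_ge0 => //; exact: ltW.
  apply: (@le_trans _ _ ((e / r) * N)); first by rewrite ler_peMl.
  rewrite (_ : (_ + _) * e = k * e + (k + 1) * 2 * (e / r) * (N + k * r)); last first.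
    by field; exact: lt0r_neq0.
  rewrite -[leLHS]add0r lerD //.
  have h4 : 1 <= (k + 1) * 2 by lra.
  have h5 : 0 <= e / r by lra.
  have h6 : 0 <= e / r * N by exact: mulr_ge0.
  have h7 : 0 <= e / r * (k * r) by exact: mulr_ge0.
  nra.
have [/big//|er] := leP r e.
pose h := (k + 1) * e.
have h0 : 0 <= h by rewrite mulr_ge0 // addr_ge0.
(* If [h] is 0 then [y] equals [c] and is already in [D]; otherwise [l] below is positive and can be
   divided by. *)
have [hz|hn] := eqVneq h 0.
  exists y.
    split=> //; split=> //; have : y - c = 0.
      apply/matrixP => i j; rewrite [RHS]mxE; apply/eqP; rewrite -normr_le0.
      by apply: le_trans (enorm_entry _ _ _) _; rewrite -hz.
    by move/eqP; rewrite subr_eq0 => /eqP ->.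
  by apply: le_trans xy _; rewrite ler_wpM2r // lerDl.
have {hn}h0 : 0 < h by rewrite lt_neqAle eq_sym hn.
(* The weight is chosen so that [(1 - l) / l * h] equals [r / 2], strictly inside the Slater
   ball. *)
pose l := h / (r / 2 + h).
have den0 : 0 < r / 2 + h by rewrite addr_gt0 // divr_gt0.
have l0 : 0 < l by rewrite divr_gt0.
have lE : l * (r / 2 + h) = h by rewrite /l divfK // gt_eqF.
have l1 : l <= 1 by rewrite /l ler_pdivrMr // mul1r lerDr divr_ge0 // ltW.
pose w := l *: u + (1 - l) *: y.
have l01 : 0 <= l <= 1 by rewrite ltW.
have Pu : (V `&` (Q `&` A)) u by do !split => //; exact: DA.
have Py : (V `&` (Q `&` A)) y by do !split.
have [Vw [Qw Aw]] : (V `&` (Q `&` A)) w by have /convex_setP := cP; apply.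
(* The error [y - c] is shifted onto the Slater point: [w] becomes a convex combination of [c] and a
   point within [r / 2] of [u], both in [D]. *)
have wE : w = l *: (u + ((1 - l) / l) *: (y - c)) + (1 - l) *: c.
  rewrite /w scalerDr scalerA mulrC divfK ?gt_eqF //.
  by rewrite -addrA scalerBr subrK.
have Dw : D w.
  rewrite wE; move/convex_setP: cD; apply=> //; apply: uD.
    by apply: fA => //; exact: DA.
  rewrite addrC addKr enormZ ger0_norm; last by rewrite divr_ge0 ?subr_ge0 // ltW.
  apply: (@le_lt_trans _ _ ((1 - l) / l * h)).
    by rewrite ler_wpM2l // divr_ge0 ?subr_ge0 // ltW.
  rewrite (_ : _ / l * h = r / 2); first by lra.
  apply: (mulfI (lt0r_neq0 l0)); rewrite (_ : l * _ = (1 - l) * h); first by lra.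
  by field; exact: lt0r_neq0.
exists w => //.
apply: le_trans (ler_enorm_distD y _ _) _.
rewrite mulrDl lerD //.
have -> : y - w = l *: (y - u).
  by rewrite /w; apply/matrixP => i j; rewrite !mxE; ring.
rewrite enormZ gtr0_norm //.
have yu : enorm (y - u) <= N + k * r.
  apply: le_trans (ler_enorm_distD x _ _) _.
  rewrite enorm_distC addrC lerD //.
    rewrite /N addrC; apply: le_trans (ler_enormD _ _) _; rewrite enormN lerD //.
    exact: le_trans xM (ler_norm _).
  by apply: le_trans xy _; rewrite ler_wpM2l // ltW.
have ll : l <= (k + 1) * (2 / r) * e.
  rewrite (_ : _ * e = h / (r / 2)); last by rewrite /h invf_div; ring.
  rewrite /l ler_wpM2l ?(ltW h0) // lef_pV2 ?posrE ?divr_gt0 //.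
  by rewrite lerDl ltW.
rewrite [leRHS]mulrAC; apply: ler_pM => //; [exact: ltW|exact: enorm_ge0].
Qed.

Lemma linear_flat p' q' (f : 'M[R]_(p, q) -> 'M[R]_(p', q')) (A : set 'M[R]_(p', q')) :
  linear f -> flat A -> flat [set x | A (f x)].
Proof.
move=> lf fA x y z t Ax Ay Az /=.
have -> : x + t *: (y - z) = t *: (-1 *: z + y) + x by rewrite scaleN1r addrC (addrC y).
by rewrite !lf scaleN1r (addrC (- _)) (addrC _ (f x)); exact: fA.
Qed.

Lemma linear_convex p' q' (f : 'M[R]_(p, q) -> 'M[R]_(p', q')) (D : set 'M[R]_(p', q')) :
  linear f -> convex_set D -> convex_set [set x | D (f x)].
Proof.
move=> lf /convex_setP cD; apply/convex_setP => x y t t01 Dx Dy /=.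
have f0 : f 0 = 0.
  by have := lf 1 0 0; rewrite !scale1r addr0 => /eqP; rewrite -subr_eq0 opprD addNKr oppr_eq0 => /eqP.
by rewrite lf -[(1 - t) *: y]addr0 lf f0 addr0; exact: cD.
Qed.

(** The preimage of the affine hull serves as the flat set, and since [f] stretches norms by at most
    [k], the ball of radius [e / k] about [u] maps into the ball of radius [e] about [f u]. *)
Lemma ri_regular (n : nat) (f : 'M[R]_(p, q) -> 'rV[R]_n) Q (C : set 'rV[R]_n) V u :
  linear f -> polyhedral Q -> polyhedral V -> convex_set C ->
  Q u -> ri C (f u) -> V u -> bounded_regular (Q `&` [set x | C (f x)]) V.
Proof.
move=> lf pQ pV cC Qu [Cu [e e0 eP]] Vu.
have [k k0 kP] := linear_bounded lf.
have [|L [a LE]] := @affine_hullE R 1 n C; first by exists (f u).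
apply: (@slater_regular Q [set x | affine_hull C (f x)] _ V u (e / k)) => //.
- by rewrite LE; apply: polyhedral_preimage => //; exact: polyhedral_affine.
- exact: linear_convex.
- by rewrite LE; apply: linear_flat => //; exact: affine_flat.
- by move=> x /=; exact: sub_affine_hull.
- exact: divr_gt0.
move=> y Ay yu; apply: eP => //.
have -> : f y - f u = f (y - u) by rewrite addrC -scaleN1r -lf scaleN1r addrC.
by apply: le_lt_trans (kP _) _; rewrite mulrC -ltr_pdivlMr.
Qed.

(** Each case of PPS is a Slater argument: the first with trivial polyhedral part, the second with
    [D] the whole space, the third with [f] the projection to the coordinates of the second
    factor. *)
Lemma PPS_regular C (L : {vspace 'M[R]_(p, q)}) a :
  convex_set C -> PPS C (affine L a) -> bounded_regular C (affine L a).
Proof.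
have pV := polyhedral_affine L a.
move=> cC [[u [Vu [Cu [e e0 eP]]]]|[[u [Vu Cu]] pC]|].
- have [|L' [a' LE]] := @affine_hullE R p q C; first by exists u.
  rewrite -[C]setTI; apply: (@slater_regular setT (affine_hull C) _ _ u e) => //.
  + exact: polyhedralT.
  + by rewrite LE; exact: polyhedral_affine.
  + by rewrite LE; exact: affine_flat.
  + exact: sub_affine_hull.
- rewrite -[C]setIT; apply: (@slater_regular C setT setT _ u 1) => //.
  + exact: polyhedralT.
- move=> [n1 [n2 [s [C1 [C2 [_ [_ [_ cC2 _]] CE pC1 [u [Vu [/= Cu1 Cu2]]]]]]]]].
  pose f1 (x : 'M[R]_(p, q)) := \row_i x (s (inl i)).1 (s (inl i)).2.
  pose f2 (x : 'M[R]_(p, q)) := \row_i x (s (inr i)).1 (s (inr i)).2.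
  rewrite (_ : C = [set x | C1 (f1 x)] `&` [set x | C2 (f2 x)]) //.
  apply: (@ri_regular n2 f2 _ _ _ u) => //.
  + by move=> t x y; apply/matrixP => i j; rewrite !mxE.
  + apply: polyhedral_preimage => //.
    by move=> t x y; apply/matrixP => i j; rewrite !mxE.
Qed.

End Regularity.

(** * Coordinates in dimension three *)

Section Rows.
Context {R : realType}.
Implicit Types (u v : 'rV[R]_3) (a b c r : R).

Definition vec3 a b c : 'rV[R]_3 := \row_i [:: a; b; c]`_i.

Lemma ord3P (P : 'I_3 -> Prop) : P 0 -> P 1 -> P 2 -> forall i, P i.
Proof.
move=> h0 h1 h2 [[|[|[|//]]] Hi].
- by rewrite (_ : Ordinal Hi = 0) //; apply: val_inj.
- by rewrite (_ : Ordinal Hi = 1) //; apply: val_inj.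
- by rewrite (_ : Ordinal Hi = 2) //; apply: val_inj.
Qed.

Lemma big_ord3 (F : 'I_3 -> R) : \sum_i F i = F 0 + F 1 + F 2.
Proof.
rewrite 3!big_ord_recl big_ord0 addr0 addrA; congr (_ + F _ + F _); exact: val_inj.
Qed.

Lemma dot3 u v : dot u v = u 0 0 * v 0 0 + u 0 1 * v 0 1 + u 0 2 * v 0 2.
Proof. by rewrite /dot big_ord1 big_ord3. Qed.

Lemma row3P u v : u 0 0 = v 0 0 -> u 0 1 = v 0 1 -> u 0 2 = v 0 2 -> u = v.
Proof. by move=> h0 h1 h2; apply/rowP; exact: ord3P. Qed.

Lemma vec3E a b c :
  ((vec3 a b c) 0 0 = a) * ((vec3 a b c) 0 1 = b) * ((vec3 a b c) 0 2 = c).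
Proof. by rewrite /vec3 !mxE. Qed.

Lemma enorm3_le u : enorm u <= `|u 0 0| + `|u 0 1| + `|u 0 2|.
Proof. by apply: le_trans (enorm_le_sum _) _; rewrite big_ord1 big_ord3. Qed.

End Rows.

(** * The exponential cone, its tangents and its dual *)

Section ExpCone.
Context {R : realType}.
Implicit Types (p u z : 'rV[R]_3) (a b c r s : R).

(** The gap between [expR] and its tangent at 0; it measures how far a point of the graph is from a
    given tangent. *)
Definition phi s : R := expR s - 1 - s.

Lemma phi_ge0 s : 0 <= phi s.
Proof. by rewrite /phi; have := expR_ge1Dx s; lra. Qed.

(** Square [1 + s / 2 <= expR (s / 2)]; the bound -2 is what keeps the left side nonnegative. This
    inequality is the source of the exponent 1/2 on exposed rays. *)
Lemma phi_quad s : -2 <= s -> s ^+ 2 / 4 <= phi s.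
Proof.
move=> s2; have h := expR_ge1Dx (s / 2).
have : (1 + s / 2) ^+ 2 <= expR (s / 2) ^+ 2.
  by rewrite ler_pXn2r ?nnegrE ?expR_ge0 //; lra.
rewrite -expRM_natl (_ : 2%:R * (s / 2) = s); last by field.
by rewrite /phi; lra.
Qed.

Lemma phi_lin s : s <= -2 -> - s / 2 <= phi s.
Proof. by move=> s2; have := expR_gt0 s; rewrite /phi; lra. Qed.

Lemma phi_eq0 s : phi s = 0 -> s = 0.
Proof.
move=> s0; have [s2|/ltW/phi_quad] := leP s (-2); last by rewrite s0; nra.
by have := phi_lin s2; lra.
Qed.

(* The graph of [y * exp (x / y)] is the supremum of its tangents, so that
   [K_exp] is an intersection of half-spaces. *)
Lemma K_expP p : K_exp p <->
  [/\ 0 <= p 0 1, 0 <= p 0 2 &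
      forall r, expR r * (p 0 0 + (1 - r) * p 0 1) <= p 0 2].
Proof.
rewrite /K_exp /=; set x := p 0 0; set y := p 0 1; set z := p 0 2.
split=> [[[y0 h]|[x0 z0 ->]]|[y0 z0 h]].
- split; first exact: ltW.
    by apply: le_trans h; rewrite mulr_ge0 ?expR_ge0 // ltW.
  move=> r; apply: le_trans h.
  have -> : expR (x / y) = expR r * expR (x / y - r) by rewrite -expRD addrC subrK.
  rewrite mulrCA ler_wpM2l ?expR_ge0 //.
  have h := expR_ge1Dx (x / y - r).
  apply: le_trans (ler_wpM2l (ltW y0) h).
  by rewrite le_eqVlt; apply/orP; left; apply/eqP; field; exact: lt0r_neq0.
- split=> // r; rewrite mulr0 addr0; apply: le_trans z0.
  by rewrite mulr_ge0_le0 ?expR_ge0.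
- have [y00|yn0] := eqVneq y 0.
    right; split=> //; rewrite leNgt; apply/negP => x0.
    (* For x > 0 and y = 0 this slope gives x exp (z / x) >= x + z > z, against the tangent
       inequality. *)
    have := h (z / x); rewrite y00 mulr0 addr0.
    have := expR_ge1Dx (z / x); rewrite -(ler_pM2r x0) mulrDl divfK ?gt_eqF //; lra.
  have {yn0}y0 : 0 < y by rewrite lt_neqAle eq_sym yn0.
  left; split=> //; apply: le_trans (h (x / y)); rewrite mulrC.
  rewrite (_ : x + _ = y) //; by field; exact: lt0r_neq0.
Qed.

Lemma K_exp0 : K_exp (0 : 'rV[R]_3).
Proof. by apply/K_expP; rewrite !mxE; split => // r; rewrite mulr0 addr0 mulr0. Qed.

Lemma K_exp_cone : convex_cone (@K_exp R).
Proof.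
split; first by exists 0; exact: K_exp0.
- apply/convex_setP => p p' t /andP[t0 t1] /K_expP[y0 z0 h] /K_expP[y0' z0' h'].
  apply/K_expP; rewrite !mxE; split=> [||r].
  + by rewrite addr_ge0 // mulr_ge0 // subr_ge0.
  + by rewrite addr_ge0 // mulr_ge0 // subr_ge0.
  + have t1' : 0 <= 1 - t by lra.
    by have := ler_wpM2l t0 (h r); have := ler_wpM2l t1' (h' r); lra.
- move=> t p t0 /K_expP[y0 z0 h]; apply/K_expP; rewrite !mxE; split=> [||r].
  + exact: mulr_ge0.
  + exact: mulr_ge0.
  + by have := ler_wpM2l t0 (h r); lra.
Qed.

Lemma K_exp_graph r : K_exp (vec3 r 1 (expR r)).
Proof. by left; rewrite !vec3E divr1 mul1r; split. Qed.

Lemma K_exp_left : K_exp (vec3 (-1) 0 0 : 'rV[R]_3).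
Proof. by right; rewrite !vec3E; split => //; rewrite lerN10. Qed.

Lemma K_exp_up : K_exp (vec3 0 0 1 : 'rV[R]_3).
Proof. by right; rewrite !vec3E; split. Qed.

Lemma dual_K_expP z : dual_cone K_exp z ->
  [/\ z 0 0 <= 0, 0 <= z 0 2 & forall r, 0 <= z 0 0 * r + z 0 1 + z 0 2 * expR r].
Proof.
move=> h; split.
- by have := h _ K_exp_left; rewrite dot3 !vec3E; lra.
- by have := h _ K_exp_up; rewrite dot3 !vec3E; lra.
- by move=> r; have := h _ (K_exp_graph r); rewrite dot3 !vec3E; lra.
Qed.

Lemma dual_K_exp_v_ge0 z : dual_cone K_exp z -> z 0 0 = 0 -> 0 <= z 0 1.
Proof.
move=> /dual_K_expP[_ w0 h] u0; rewrite leNgt; apply/negP => v0.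
have w1 : 0 < z 0 2.
  rewrite lt_neqAle w0 andbT; apply/eqP => wz.
  by have := h 0; rewrite -wz u0; lra.
(* This [r] makes the last term half of [- z 0 1], leaving the negative value [z 0 1 / 2]. *)
have := h (ln (- z 0 1 / (2 * z 0 2))).
rewrite lnK ?posrE ?divr_gt0 ?mulr_gt0 //; last lra.
rewrite (_ : _ + z 0 2 * _ = z 0 1 / 2); first lra.
by rewrite u0; field; exact: lt0r_neq0.
Qed.

Lemma dual_K_exp_w_gt0 z : dual_cone K_exp z -> z 0 0 < 0 -> 0 < z 0 2.
Proof.
move=> /dual_K_expP[_ w0 h] u0; rewrite lt_neqAle w0 andbT; apply/eqP => wz.
(* With vanishing last coordinate the functional is affine in [r], and takes the value -1 here. *)
have := h ((z 0 1 + 1) / (- z 0 0)); rewrite -wz mul0r addr0 invrN mulrN mulrN.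
rewrite mulrCA divff ?mulr1 ?lt_eqF //; lra.
Qed.

End ExpCone.

(** * Residual bounds for a single block *)

Section Residuals.
Context {R : realType}.
Implicit Types (p u z : 'rV[R]_3) (a b r s t M : R) (G : set 'rV[R]_3).

Definition fin_gen G := exists (n : nat) (g : 'I_n -> 'rV[R]_3),
  G = [set p | exists2 c : 'I_n -> R, forall i, 0 <= c i & p = \sum_i c i *: g i].

(** A Hölder bound with exponent 1/2 for the face of [G] exposed by [z], with [t] the square root of
    the residual; one [M] serves as norm bound and as coefficient. *)
Definition half_residual G z := forall M, exists2 k, 0 <= k &
  forall p t, G p -> enorm p <= M -> 0 <= t <= 1 -> dot p z <= M * t ^+ 2 ->
    exists2 p', G p' /\ dot p' z = 0 & enorm (p - p') <= k * t.

Lemma half_residualW G z :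
  (forall M, 0 <= M -> exists2 k, 0 <= k &
    forall p t, G p -> enorm p <= M -> 0 <= t <= 1 -> dot p z <= M * t ^+ 2 ->
    exists2 p', G p' /\ dot p' z = 0 & enorm (p - p') <= k * t) ->
  half_residual G z.
Proof.
move=> h M; have [/h //|M0] := leP 0 M; exists 0 => // p t _ pM.
by have := enorm_ge0 p; lra.
Qed.

Lemma orthogonal_compl1E z : orthogonal_compl [set z] = [set p | dot p z = 0].
Proof.
apply/seteqP; split=> p /=; first by move=> /(_ z erefl); rewrite dotC.
by move=> h _ ->; rewrite dotC.
Qed.

Section FinGen.
Variables (n : nat) (g : 'I_n -> 'rV[R]_3) (z : 'rV[R]_3).
Let G := [set p | exists2 c : 'I_n -> R, forall i, 0 <= c i & p = \sum_i c i *: g i].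
Hypothesis zG : dual_cone G z.

Let gz i : 0 <= dot (g i) z.
Proof.
apply: zG; exists (fun j => (i == j)%:R) => [j|]; first exact: ler0n.
rewrite (bigD1 i) //= eqxx scale1r big1 ?addr0 // => j ji.
by rewrite eq_sym (negbTE ji) scale0r.
Qed.

(** Generators off the hyperplane become 0 instead of being removed, which keeps the index type. *)
Let g' i := if dot (g i) z == 0 then g i else 0.

Let g'P (c : 'I_n -> R) : (forall i, 0 <= c i) -> let p' := \sum_i c i *: g' i in
  G p' /\ dot p' z = 0.
Proof.
move=> c0; split.
  exists (fun i => if dot (g i) z == 0 then c i else 0) => [i|].
    by case: ifP.
  by apply: eq_bigr => i _; rewrite /g'; case: ifP; rewrite ?scaler0 ?scale0r.
rewrite dot_suml big1 // => i _; rewrite dotZl /g'.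
by case: ifP => [/eqP ->|]; rewrite ?dot0l mulr0.
Qed.

Lemma fin_gen_orth_aux : fin_gen (G `&` orthogonal_compl [set z]).
Proof.
exists n, g'; rewrite orthogonal_compl1E; apply/seteqP; split=> p /=; last first.
  by move=> [c c0 ->]; have := g'P c0.
move=> [[c c0 ->]]; rewrite dot_suml => hs; exists c => //.
have h i : c i * dot (g i) z = 0.
  rewrite -dotZl; apply: (psumr_eq0P _ hs) => // j _.
  by rewrite dotZl mulr_ge0.
apply: eq_bigr => i _; rewrite /g'; case: ifP => // /negbT gn.
by have /eqP := h i; rewrite mulf_eq0 (negbTE gn) orbF => /eqP ->; rewrite !scale0r.
Qed.

(** Dropping the generators with positive product suffices: each has coefficient at most
    [M * t ^+ 2] over its product. This is linear in the residual, and is relaxed to order [t] by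
    [t <= 1]. *)
Lemma fin_gen_residual_aux : half_residual G z.
Proof.
apply: half_residualW => M M0.
pose k := \sum_i enorm (g i) / dot (g i) z.
have k0 : 0 <= k by apply: sumr_ge0 => i _; rewrite divr_ge0 ?enorm_ge0.
exists (k * M) => [|p t]; first exact: mulr_ge0.
move=> [c c0 ->] _ /andP[t0 t1]; rewrite dot_suml => hs.
exists (\sum_i c i *: g' i); first exact: g'P.
rewrite -sumrB; apply: le_trans (ler_enorm_sum _ _ _) _.
apply: (@le_trans _ _ (\sum_i enorm (g i) / dot (g i) z * (M * t))); last first.
  by rewrite -mulr_suml mulrA.
apply: ler_sum => i _; rewrite -scalerBr enormZ ger0_norm // /g'; case: ifPn => gz0.
  by rewrite subrr enorm0 mulr0 mulr_ge0 ?divr_ge0 ?enorm_ge0 ?mulr_ge0.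
have gp : 0 < dot (g i) z by rewrite lt_neqAle eq_sym gz0 gz.
rewrite subr0 mulrC -mulrA ler_wpM2l ?enorm_ge0 // -ler_pdivrMl ?invr_gt0 // invrK.
have : c i * dot (g i) z <= M * t ^+ 2.
  apply: le_trans hs; rewrite (bigD1 i) //= dotZl lerDl sumr_ge0 // => j _.
  by rewrite dotZl mulr_ge0.
have tt : t ^+ 2 <= t by nra.
by rewrite mulrC => /le_trans; apply; rewrite ler_wpM2l.
Qed.

End FinGen.

Lemma fin_gen_orth G z : fin_gen G -> dual_cone G z ->
  fin_gen (G `&` orthogonal_compl [set z]).
Proof. by move=> [n [g ->]]; exact: fin_gen_orth_aux. Qed.

Lemma fin_gen_residual G z : fin_gen G -> dual_cone G z -> half_residual G z.
Proof. by move=> [n [g ->]]; exact: fin_gen_residual_aux. Qed.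

(** Uses b <= (1 + b)^2 to avoid a square root in the constants. *)
Lemma le_of_sqr_le a b t : 0 <= b -> 0 <= t -> a ^+ 2 <= b * t ^+ 2 -> a <= (1 + b) * t.
Proof.
move=> b0 t0 h; have [a0|/ltW a0] := leP a 0.
  by apply: le_trans a0 _; apply: mulr_ge0 => //; lra.
have bt : 0 <= (1 + b) * t by apply: mulr_ge0 => //; lra.
rewrite -(@ler_pXn2r _ 2) ?nnegrE //; apply: le_trans h _.
rewrite exprMn ler_wpM2r ?sqr_ge0 //; nra.
Qed.

(** Such [z] exposes the two-dimensional face y = 0, and y itself is O(t^2). Only x > 0 is delicate:
    M >= y exp (x / y) >= y (x / 2y)^2 gives x^2 <= 4 M y, so x is O(t). *)
Lemma exp_residual_u0 z : z 0 0 = 0 -> 0 < z 0 1 -> z 0 2 = 0 ->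
  half_residual K_exp z /\ fin_gen (K_exp `&` orthogonal_compl [set z]).
Proof.
move=> u0 v0 w0.
have dE p : dot p z = p 0 1 * z 0 1 by rewrite dot3 u0 w0 !mulr0 add0r addr0.
split.
  apply: half_residualW => M M0; set v := z 0 1 in v0 *.
  pose k1 := 1 + 4 * M ^+ 2 / v.
  have k10 : 0 <= 4 * M ^+ 2 / v by rewrite divr_ge0 ?mulr_ge0 ?sqr_ge0 // ltW.
  exists (k1 + M / v) => [|p t Kp pM /andP[t0 t1]].
    by rewrite !addr_ge0 // divr_ge0 // ltW.
  rewrite dE -/v; set x := p 0 0; set y := p 0 1; set w := p 0 2 => yM.
  have wM : `|w| <= M := le_trans (enorm_entry _ _ _) pM.
  have tt : t ^+ 2 <= t by nra.
  have y1 : y <= M / v * t ^+ 2 by rewrite mulrAC ler_pdivlMr.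
  have [y0 z0 _] := (K_expP p).1 Kp.
  exists (vec3 (Num.min x 0) 0 w).
    rewrite dE vec3E mul0r; split=> //; right; rewrite !vec3E; split=> //.
    by rewrite ge_min lexx orbT.
  apply: le_trans (enorm3_le _) _; rewrite !mxE /= -/x -/y -/w subr0 subrr normr0 addr0.
  rewrite (ger0_norm y0) mulrDl lerD //; last first.
    by apply: le_trans y1 _; rewrite ler_wpM2l // divr_ge0 // ltW.
  have [x0|x0] := leP x 0.
    by rewrite subrr normr0 mulr_ge0 // addr_ge0.
  rewrite subr0 gtr0_norm //; apply: le_of_sqr_le => //.
  have [[yp Kp']|[]] : (0 < y /\ y * expR (x / y) <= w) \/ [/\ x <= 0, 0 <= w & y = 0].
  - exact: Kp.
  - have h := expR_ge1Dx (x / y / 2).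
    have xy : 0 < x / y by exact: divr_gt0.
    have : (x / y / 2) ^+ 2 <= expR (x / y / 2) ^+ 2.
      by rewrite ler_pXn2r ?nnegrE ?expR_ge0 //; lra.
    rewrite -expRM_natl (_ : 2%:R * _ = x / y); last by field; exact: lt0r_neq0.
    move=> h2; have h3 : y * (x / y / 2) ^+ 2 <= M.
      apply: le_trans (le_trans Kp' (le_trans (ler_norm _) wM)).
      by rewrite ler_wpM2l // ltW.
    have : x ^+ 2 <= 4 * M * y.
      rewrite (_ : x ^+ 2 = 4 * (y * (x / y / 2) ^+ 2) * y); last first.
        by field; exact: lt0r_neq0.
      by rewrite ler_wpM2r // ler_wpM2l.
    move=> /le_trans; apply.
    rewrite (_ : 4 * M ^+ 2 / v * t ^+ 2 = 4 * M * (M / v * t ^+ 2)); last by ring.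
    by rewrite ler_wpM2l // mulr_ge0.
  - by move=> h; lra.
exists 2, (fun i => [:: vec3 (-1) 0 0; vec3 0 0 1]`_i).
rewrite orthogonal_compl1E; apply/seteqP; split=> p /=; rewrite dE.
  move=> [Kp /eqP]; rewrite mulf_eq0 (gt_eqF v0) orbF => /eqP y0.
  case: Kp => [[]|[x0 z0 _]]; first by rewrite y0 ltxx.
  exists (fun i => [:: - p 0 0; p 0 2]`_i).
    by case=> [[|[|//]]] Hi /=; lra.
  rewrite !big_ord_recl big_ord0 addr0 /=.
  by apply: row3P; rewrite !mxE /= ?mulr0 ?mulr1 ?addr0 ?add0r ?mulrN1 ?opprK.
move=> [c c0 ->]; rewrite !big_ord_recl big_ord0 addr0 /=.
have c1 := c0 ord0; have c2 := c0 (lift ord0 ord0).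
split; last by rewrite !mxE /= !mulr0 addr0 mul0r.
right; rewrite !mxE /= !mulr0 !add0r !addr0 mulr1 mulrN1; split=> //; lra.
Qed.

(** * Exposing vectors with negative first coordinate *)

Section Unegative.
Variable z : 'rV[R]_3.
Hypotheses (zK : dual_cone K_exp z) (u0 : z 0 0 < 0).
Let c := - z 0 0.
Let w := z 0 2.
Let q := ln (c / w).
(* [mu] is the minimum over [r] of the product of [z] with [(r, 1, exp r)],
   attained at [r = q]: the exposed face is [0] or a ray according to its sign. *)
Let mu := z 0 1 + c * (1 - q).

Let c0 : 0 < c. Proof. by rewrite oppr_gt0. Qed.
Let w0 : 0 < w. Proof. exact: dual_K_exp_w_gt0. Qed.
Let wq : w * expR q = c.
Proof. by rewrite lnK ?posrE ?divr_gt0 // mulrC divfK ?gt_eqF. Qed.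

Let mu0 : 0 <= mu.
Proof.
have [_ _ /(_ q)] := dual_K_expP zK; rewrite -/w wq /mu /c; lra.
Qed.

Let dE p : dot p z = - c * p 0 0 + z 0 1 * p 0 1 + w * p 0 2.
Proof. by rewrite dot3 /c /w; ring. Qed.

(** Slope ln (c / b) keeps the coefficient [c] on x for every weight [b] on z. Weight [w] yields
    [mu * y <= dot p z]; weight [w / 2] leaves half of [w] to bound z. *)
Let tangent p b : K_exp p -> 0 < b -> c * (p 0 0 + (1 - ln (c / b)) * p 0 1) <= b * p 0 2.
Proof.
move=> /K_expP[_ _ /(_ (ln (c / b)))] h b0.
have := ler_wpM2l (ltW b0) h; rewrite mulrA.
by rewrite lnK ?posrE ?divr_gt0 // (mulrC b (c / b)) divfK ?gt_eqF.
Qed.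

(** Here [z] is interior to the dual cone, so [dot p z] dominates the norm: it bounds y, then z, and
    finally x through the expression of the product. *)
Lemma exp_residual_interior : 0 < mu ->
  half_residual K_exp z /\ K_exp `&` orthogonal_compl [set z] = [set 0].
Proof.
move=> mup.
pose K1 := `|z 0 1 + c * (1 - ln (c / (w / 2)))|.
pose k := (`|z 0 1| / mu + 2 * (1 + K1 / mu) + 1) / c + 1 / mu + 2 * (1 + K1 / mu) / w.
have K10 : 0 <= K1 by exact: normr_ge0.
have b1 : 0 <= K1 / mu by rewrite divr_ge0.
have b2 : 0 <= `|z 0 1| / mu by rewrite divr_ge0.
have k0 : 0 <= k.
  by rewrite /k !addr_ge0 // divr_ge0 ?(ltW c0) ?(ltW w0) // ?mulr_ge0 ?addr_ge0 // mulr_ge0 // addr_ge0.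
have bound p : K_exp p -> enorm p <= k * dot p z.
  move=> Kp; have [y0 z0 _] := (K_expP p).1 Kp.
  have h1 := tangent Kp w0.
  have h2 : c * (p 0 0 + (1 - ln (c / (w / 2))) * p 0 1) <= w / 2 * p 0 2.
    by apply: tangent => //; rewrite divr_gt0.
  set D := dot p z; have DE : D = - c * p 0 0 + z 0 1 * p 0 1 + w * p 0 2 := dE p.
  set x := p 0 0 in h1 h2 DE *; set y := p 0 1 in y0 h1 h2 DE *.
  set s := p 0 2 in z0 h1 h2 DE *.
  have yD : y <= D / mu.
    by rewrite ler_pdivlMr // /mu DE; move: h1; rewrite -/q; lra.
  have D0 : 0 <= D by rewrite -(pmulr_lge0 _ (_ : 0 < mu^-1)) ?invr_gt0 //; lra.
  have wz : w * s <= 2 * (1 + K1 / mu) * D.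
    have h3 : - (z 0 1 + c * (1 - ln (c / (w / 2)))) * y <= K1 * y.
      by rewrite ler_wpM2r // /K1 -normrN ler_norm.
    have h4 : K1 * y <= K1 / mu * D by rewrite mulrAC -mulrA ler_wpM2l.
    by lra.
  have vy : `|z 0 1 * y| <= `|z 0 1| / mu * D.
    by rewrite normrM (ger0_norm y0) mulrAC -mulrA ler_wpM2l.
  have cx : c * `|x| <= (`|z 0 1| / mu + 2 * (1 + K1 / mu) + 1) * D.
    rewrite -[c * _](ger0_norm (mulr_ge0 (ltW c0) (normr_ge0 _))) normrM normr_id -normrM.
    rewrite (_ : c * x = z 0 1 * y + w * s - D); last by rewrite DE; ring.
    apply: le_trans (ler_normB _ _) _; rewrite (ger0_norm D0).
    apply: (le_trans (lerD (ler_normD _ _) (lexx _))).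
    by rewrite (ger0_norm (mulr_ge0 (ltW w0) z0)); lra.
  apply: le_trans (enorm3_le _) _; rewrite -/x -/y -/s (ger0_norm y0) (ger0_norm z0).
  rewrite /k 2!mulrDl lerD // ?lerD //.
  + by rewrite mulrAC ler_pdivlMr // mulrC.
  + by rewrite mul1r mulrC.
  + by rewrite mulrAC ler_pdivlMr // mulrC.
split.
  apply: half_residualW => M M0; exists (k * M) => [|p t Kp _ /andP[t0 t1] pz].
    exact: mulr_ge0.
  exists 0; first by split; [exact: K_exp0|rewrite dot0l].
  rewrite subr0; apply: le_trans (bound p Kp) _; rewrite -mulrA ler_wpM2l //.
  by apply: le_trans pz _; rewrite ler_wpM2l //; nra.
rewrite orthogonal_compl1E; apply/seteqP; split=> p /=.
  move=> [Kp pz]; apply/matrixP => i j; rewrite [RHS]mxE; apply/eqP.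
  rewrite -normr_le0; apply: le_trans (enorm_entry _ _ _) _.
  by apply: le_trans (bound p Kp) _; rewrite pz mulr0.
by move=> ->; rewrite dot0l; split => //; exact: K_exp0.
Qed.

(** With [s] the deviation of x / y from the point of tangency, the product splits into a curvature
    term and the height above the graph, both nonnegative on the cone. *)
Let dotE p : mu = 0 -> 0 < p 0 1 -> let y := p 0 1 in let s := p 0 0 / y - q in
  dot p z = c * (y * phi s) + w * (p 0 2 - y * expR (p 0 0 / y)).
Proof.
move=> m0 yp /=; set y := p 0 1 in yp *; set s := p 0 0 / y - q.
have xE : p 0 0 = y * (s + q) by rewrite /s; field; exact: lt0r_neq0.
have eE : expR (p 0 0 / y) = expR s * expR q by rewrite -expRD /s subrK.
have zE : z 0 1 = - c * (1 - q) by move: m0; rewrite /mu; lra.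
rewrite dE eE xE zE /phi -/y.
have -> : w * (p 0 2 - y * (expR s * expR q)) = w * p 0 2 - y * expR s * (w * expR q).
  by ring.
by rewrite wq; ring.
Qed.

Lemma exp_exposed_ray : mu = 0 -> K_exp `&` orthogonal_compl [set z] =
  [set b *: vec3 q 1 (expR q) | b in [set b : R | 0 <= b]].
Proof.
move=> m0.
rewrite orthogonal_compl1E; apply/seteqP; split=> p /=.
  move=> [Kp pz]; have [y0 z0 _] := (K_expP p).1 Kp.
  exists (p 0 1) => //=.
  have [yz|yn] := eqVneq (p 0 1) 0.
    move: pz; rewrite dE yz mulr0 addr0 => pz.
    have x0 : p 0 0 <= 0 by case: Kp => [[]|[]//]; rewrite yz ltxx.
    have cx : 0 <= c * - p 0 0 by rewrite mulr_ge0 ?oppr_ge0 // ltW.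
    have ws : 0 <= w * p 0 2 by rewrite mulr_ge0 // ltW.
    rewrite scale0r; apply: row3P; rewrite mxE ?yz //; symmetry.
      have /eqP : c * p 0 0 = 0 by lra.
      by rewrite mulf_eq0 (gt_eqF c0) => /eqP.
    have /eqP : w * p 0 2 = 0 by lra.
    by rewrite mulf_eq0 (gt_eqF w0) => /eqP.
  have yp : 0 < p 0 1 by rewrite lt_neqAle eq_sym yn.
  move: pz; rewrite dotE //; set s := p 0 0 / p 0 1 - q => D.
  have Kz : 0 <= p 0 2 - p 0 1 * expR (p 0 0 / p 0 1).
    by case: Kp => [[_]|[_ _ yz]]; [rewrite subr_ge0|rewrite yz ltxx in yp].
  have h1 : 0 <= c * (p 0 1 * phi s) by rewrite !mulr_ge0 ?phi_ge0 // ltW.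
  have h2 := mulr_ge0 (ltW w0) Kz.
  have /eqP : c * (p 0 1 * phi s) = 0 by lra.
  rewrite !mulf_eq0 (gt_eqF c0) (gt_eqF yp) => /eqP/phi_eq0 s0.
  have xq : p 0 0 / p 0 1 = q by apply/eqP; rewrite -subr_eq0 -/s s0.
  have /eqP : w * (p 0 2 - p 0 1 * expR (p 0 0 / p 0 1)) = 0 by lra.
  rewrite mulf_eq0 (gt_eqF w0) subr_eq0 xq => /eqP zq.
  apply: row3P; rewrite mxE vec3E ?mulr1 //.
  by rewrite -xq mulrC divfK ?gt_eqF.
move=> [d /= d0 <-]; split.
  have [_ _ sK] := @K_exp_cone R; exact: sK d0 (K_exp_graph q).
by rewrite dotZl dotE ?vec3E // divr1 subrr /phi expR0; ring.
Qed.

(** The approximant keeps y and moves to the exposed ray, so the error in x is [y * s], controlled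
    through [y * phi s]; the error in z reduces to these two and the height above the graph. *)
Lemma exp_residual_ray : mu = 0 ->
  half_residual K_exp z /\ fin_gen (K_exp `&` orthogonal_compl [set z]).
Proof.
move=> m0; split.
  apply: half_residualW => M M0.
  (* Naming the quotients through an existential keeps them opaque to the arithmetic below. *)
  have [[Nc NcE] [Nw NwE]] : (exists n, n = M / c) /\ (exists n, n = M / w).
    by split; eexists.
  pose k1 := (1 + 4 * M * (Nc)) + 2 * (Nc).
  have Mc : 0 <= Nc by rewrite NcE divr_ge0 // ltW.
  have Mw : 0 <= Nw by rewrite NwE divr_ge0 // ltW.
  have k10 : 0 <= k1 by rewrite /k1 !addr_ge0 // !mulr_ge0.
  have q0 : 0 <= expR q := expR_ge0 q.
  have r0 : 0 <= expR q * (Nc + k1) by rewrite mulr_ge0 // addr_ge0.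
  exists (k1 + Nc + (Nw + expR q * (Nc + k1))) => [|p t Kp pM /andP[t0 t1] pz].
    by apply: addr_ge0; apply: addr_ge0.
  have [y0 z0 _] := (K_expP p).1 Kp.
  have tt : t ^+ 2 <= t by nra.
  have t20 : 0 <= t ^+ 2 := sqr_ge0 t.
  set y := p 0 1 in y0.
  have yM : y <= M := le_trans (ler_norm _) (le_trans (enorm_entry p 0 1) pM).
  exists (vec3 (y * q) y (y * expR q)).
    have [yz|yn] := eqVneq y 0.
      rewrite yz !mul0r (_ : vec3 0 0 0 = 0); last by apply: row3P; rewrite !mxE.
      by split; [exact: K_exp0|rewrite dot0l].
    have yp : 0 < y by rewrite lt_neqAle eq_sym yn.
    have yq : y * q / y = q by rewrite mulrAC divff ?mul1r.
    split; first by left; rewrite !vec3E yq.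
    rewrite dotE ?vec3E // yq /phi !subrr expR0; ring.
  apply: le_trans (enorm3_le _) _; rewrite !mxE /= -/y subrr normr0 addr0.
  have [yz|yn] := eqVneq y 0.
    rewrite yz !mul0r !subr0; move: pz; rewrite dE -/y yz mulr0 addr0 => pz.
    have x0 : p 0 0 <= 0.
      by case: Kp => [[]|[]//]; rewrite -/y yz ltxx.
    have cx : 0 <= c * - p 0 0 by rewrite mulr_ge0 ?oppr_ge0 // ltW.
    have ws : 0 <= w * p 0 2 by rewrite mulr_ge0 // ltW.
    rewrite (ler0_norm x0) (ger0_norm z0).
    have h1 : - p 0 0 <= Nc * t ^+ 2 by rewrite NcE mulrAC ler_pdivlMr //; lra.
    have h2 : p 0 2 <= Nw * t ^+ 2 by rewrite NwE mulrAC ler_pdivlMr //; lra.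
    have h3 : Nc * t ^+ 2 <= Nc * t by rewrite ler_wpM2l.
    have h4 : Nw * t ^+ 2 <= Nw * t by rewrite ler_wpM2l.
    have h5 : 0 <= k1 * t by rewrite mulr_ge0.
    have h6 : 0 <= expR q * (Nc + k1) * t by rewrite mulr_ge0.
    lra.
  have yp : 0 < y by rewrite lt_neqAle eq_sym yn.
  have := pz; rewrite dotE // -/y; set s := p 0 0 / y - q => D.
  have xE : p 0 0 = y * (s + q) by rewrite /s; field.
  have eE : expR (p 0 0 / y) = expR s * expR q by rewrite -expRD /s subrK.
  have Kz : 0 <= p 0 2 - y * expR (p 0 0 / y).
    case: Kp => [[_]|[_ _ yz]]; first by rewrite subr_ge0.
    by move: yp; rewrite /y yz ltxx.
  have yphi0 : 0 <= y * phi s by rewrite mulr_ge0 ?phi_ge0.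
  have D1 : y * phi s <= Nc * t ^+ 2.
    rewrite NcE mulrAC ler_pdivlMr // mulrC.
    by have := mulr_ge0 (ltW w0) Kz; lra.
  have D2 : p 0 2 - y * expR (p 0 0 / y) <= Nw * t ^+ 2.
    rewrite NwE mulrAC ler_pdivlMr // mulrC.
    by have := mulr_ge0 (ltW c0) yphi0; lra.
  have h3 : Nc * t ^+ 2 <= Nc * t by rewrite ler_wpM2l.
  have h4 : Nw * t ^+ 2 <= Nw * t by rewrite ler_wpM2l.
  (* For [s <= -2] the bound is linear; otherwise (y s)^2 <= 4 y (y phi s) <= 4 M Nc t^2, and taking
     the root costs half of the exponent. *)
  have ys : `|y * s| <= k1 * t.
    have [s2|/ltW s2] := leP s (-2).
      have s3 : - (y * s) <= 2 * (y * phi s) by have := ler_wpM2l y0 (phi_lin s2); lra.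
      have h : 0 <= (1 + 4 * M * Nc) * t by rewrite mulr_ge0 // addr_ge0 // !mulr_ge0.
      by rewrite ler0_norm ?mulr_ge0_le0 // ?(le_trans s2) // /k1 mulrDl; lra.
    have h : `|y * s| <= (1 + 4 * M * (Nc)) * t.
      apply: le_of_sqr_le => //; first by rewrite !mulr_ge0.
      have h := le_trans (ler_wpM2l y0 (phi_quad s2)) D1.
      have : y * (y * (s ^+ 2 / 4)) <= M * (Nc * t ^+ 2).
        by apply: ler_pM => //; rewrite mulr_ge0 // divr_ge0 ?sqr_ge0.
      by rewrite real_normK ?num_real //; lra.
    apply: le_trans h _; rewrite /k1 [leRHS]mulrDl lerDl mulr_ge0 //.
    by rewrite mulr_ge0.
  have h1 : `|p 0 0 - y * q| <= k1 * t.
    by rewrite (_ : p 0 0 - y * q = y * s) // xE; ring.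
  have h2 : `|p 0 2 - y * expR q| <= (Nw + expR q * (Nc + k1)) * t.
    rewrite (_ : _ - _ = (p 0 2 - y * expR (p 0 0 / y)) + expR q * (y * phi s + y * s)).
      apply: le_trans (ler_normD _ _) _; rewrite (ger0_norm Kz) mulrDl lerD //.
        exact: le_trans D2 h4.
      rewrite normrM (ger0_norm q0) -mulrA ler_wpM2l // mulrDl.
      apply: le_trans (ler_normD _ _) _; rewrite (ger0_norm yphi0) lerD //.
      exact: le_trans D1 h3.
    by rewrite eE /phi; ring.
  have h5 : 0 <= Nc * t by rewrite mulr_ge0.
  lra.
rewrite exp_exposed_ray //; exists 1, (fun=> vec3 q 1 (expR q)).
apply/seteqP; split=> p /=.
  by move=> [b b0 <-]; exists (fun=> b); rewrite ?big_ord1.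
by move=> [b b0 ->]; rewrite big_ord1; exists (b ord0).
Qed.

Lemma exp_residual_neg :
  half_residual K_exp z /\ fin_gen (K_exp `&` orthogonal_compl [set z]).
Proof.
have [mz|mn] := eqVneq mu 0; first exact: exp_residual_ray.
have [|hr ->] := exp_residual_interior; first by rewrite lt_neqAle eq_sym mn.
split=> //; exists 0, (fun=> 0); apply/seteqP; split=> p /=.
  by move=> ->; exists (fun=> 0) => //; rewrite big_ord0.
by move=> [d _ ->]; rewrite big_ord0.
Qed.

End Unegative.

(** Cases on the signs of z = (u, v, w): u < 0 exposes a ray or 0; u = 0 < w exposes [F_infty],
    which is excluded; u = w = 0 < v exposes the face y = 0; z = 0 exposes the whole cone. *)
Lemma exp_residual z : dual_cone K_exp z ->
  K_exp `&` orthogonal_compl [set z] <> F_infty ->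
  half_residual K_exp z /\ (K_exp `&` orthogonal_compl [set z] = K_exp \/
   fin_gen (K_exp `&` orthogonal_compl [set z])).
Proof.
move=> zK; have [u0 w0 _] := dual_K_expP zK.
have [uz|un] := eqVneq (z 0 0) 0; last first.
  move=> _; have [|h1 h2] := exp_residual_neg zK; first by rewrite lt_neqAle un.
  by split; [|right].
have v0 := dual_K_exp_v_ge0 zK uz; rewrite orthogonal_compl1E.
have [wz|wn] := eqVneq (z 0 2) 0; last first.
  have wp : 0 < z 0 2 by rewrite lt_neqAle eq_sym wn.
  case; apply/seteqP; split=> p /=; rewrite dot3 uz mulr0 add0r.
    move=> [Kp pz]; have [y0 z0 _] := (K_expP p).1 Kp.
    have h1 : 0 <= p 0 1 * z 0 1 by exact: mulr_ge0.
    have h2 : 0 <= p 0 2 * z 0 2 by exact: mulr_ge0.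
    have /eqP : p 0 2 * z 0 2 = 0 by lra.
    rewrite mulf_eq0 (gt_eqF wp) orbF => /eqP pz0.
    case: Kp => [[yp]|[]] //; rewrite pz0 => h.
    by have := mulr_gt0 yp (expR_gt0 (p 0 0 / p 0 1)); lra.
  by move=> [x0 y0 z0]; split; [right; rewrite z0|rewrite y0 z0 !mul0r addr0].
have [vz|vn] := eqVneq (z 0 1) 0; last first.
  have [|h1] := exp_residual_u0 uz _ wz; first by rewrite lt_neqAle eq_sym vn.
  by rewrite orthogonal_compl1E; split; [|right].
have -> : z = 0 by apply: row3P; rewrite mxE.
have -> : [set p : 'rV[R]_3 | dot p 0 = 0] = setT.
  by apply/seteqP; split => // p _ /=; rewrite dot0r.
rewrite setIT; split; last by left.
apply: half_residualW => M M0; exists 0 => // p t Kp _ _ _; exists p.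
  by rewrite dot0r.
by rewrite subrr enorm0 mul0r.
Qed.

End Residuals.

(** * Products of blocks *)

Section Blocks.
Context {R : realType} {m : nat}.
Implicit Types (x y z : 'M[R]_(m, 3)) (v : 'rV[R]_3) (G : 'I_m -> set 'rV[R]_3).

Definition prod_set G : set 'M[R]_(m, 3) := [set x | forall j, G j (row j x)].

Definition emb (j : 'I_m) v : 'M[R]_(m, 3) := \matrix_(i, k) (if i == j then v 0 k else 0).

Lemma row_emb i j v : row i (emb j v) = if i == j then v else 0.
Proof. by apply/rowP => k; rewrite !mxE; case: ifP => // _; rewrite mxE. Qed.

Lemma dot_rows x z : dot x z = \sum_j dot (row j x) (row j z).
Proof.
apply: eq_bigr => j _; rewrite /dot big_ord1.
by apply: eq_bigr => k _; rewrite !mxE.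
Qed.

Lemma dot_emb j v z : dot (emb j v) z = dot v (row j z).
Proof.
rewrite dot_rows (bigD1 j) //= row_emb eqxx big1 ?addr0 // => i ij.
by rewrite row_emb (negbTE ij) dot0l.
Qed.

Lemma sum_emb x : x = \sum_j emb j (row j x).
Proof.
apply/matrixP => i k; rewrite summxE (bigD1 i) //= big1 ?addr0; first by rewrite !mxE eqxx.
by move=> j ji; rewrite mxE eq_sym (negbTE ji).
Qed.

Lemma enorm_rows x : enorm x <= \sum_j enorm (row j x).
Proof.
rewrite {1}[x]sum_emb; apply: le_trans (ler_enorm_sum _ _ _) _.
by apply: ler_sum => j _; rewrite /enorm dot_emb row_emb eqxx.
Qed.

Lemma enorm_row x j : enorm (row j x) <= enorm x.
Proof.
apply: ler_wsqrtr; rewrite [leRHS]dot_rows (bigD1 j) //= lerDl.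
by apply: sumr_ge0 => i _; exact: dot_ge0.
Qed.

Section Step.
Variables (G : 'I_m -> set 'rV[R]_3) (z : 'M[R]_(m, 3)).
Hypotheses (G0 : forall j, G j 0) (zG : dual_cone (prod_set G) z).

Lemma prod_set_emb j v : G j v -> prod_set G (emb j v).
Proof. by move=> Gv i; rewrite row_emb; case: eqP => // ->. Qed.

Lemma block_prod_set j : block (prod_set G) j = G j.
Proof.
apply/seteqP; split=> v; first by move=> [x Gx <-]; exact: Gx.
by move=> Gv; exists (emb j v); [exact: prod_set_emb|rewrite row_emb eqxx].
Qed.

Lemma dual_prod_set j : dual_cone (G j) (row j z).
Proof. by move=> v /prod_set_emb/zG; rewrite dot_emb. Qed.

(** All blocks contribute nonnegatively, so a bound on the total residual holds in every block. *)
Lemma dot_prod_set_row x j : prod_set G x -> dot (row j x) (row j z) <= dot x z.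
Proof.
move=> Gx; rewrite dot_rows (bigD1 j) //= lerDl sumr_ge0 // => i _.
exact: (dual_prod_set (Gx i)).
Qed.

Lemma prod_set_orth : prod_set G `&` orthogonal_compl [set z] =
  prod_set (fun j => G j `&` orthogonal_compl [set row j z]).
Proof.
apply/seteqP; split=> x.
  move=> [Gx /(_ z erefl) zx] j; split=> // _ ->; rewrite dotC.
  apply/eqP; rewrite eq_le (dual_prod_set (Gx j)) andbT -[leRHS]zx (dotC z x).
  exact: dot_prod_set_row.
move=> Gx; split=> [j|_ ->]; first exact: (Gx j).1.
by rewrite dot_rows big1 // => j _; exact: ((Gx j).2 _ erefl).
Qed.

Lemma prod_set_residual :
  (forall j, half_residual (G j) (row j z)) ->
  forall M, exists2 k, 0 <= k & forall x t, prod_set G x -> enorm x <= M ->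
    0 <= t <= 1 -> dot x z <= M * t ^+ 2 ->
    exists2 y, (prod_set G `&` orthogonal_compl [set z]) y & enorm (x - y) <= k * t.
Proof.
move=> hr M.
have /choice[k kP] : forall j, exists k, 0 <= k /\
    forall p t, G j p -> enorm p <= M -> 0 <= t <= 1 -> dot p (row j z) <= M * t ^+ 2 ->
    exists2 p', G j p' /\ dot p' (row j z) = 0 & enorm (p - p') <= k * t.
  by move=> j; have [k k0 kP] := hr j M; exists k.
exists (\sum_j k j) => [|x t Gx xM t01 xz].
  by apply: sumr_ge0 => j _; exact: (kP j).1.
have /choice[p pP] : forall j, exists p, [/\ G j p, dot p (row j z) = 0 &
    enorm (row j x - p) <= k j * t].
  move=> j.
    have xjM := le_trans (enorm_row x j) xM.
    have [|p [Gp pz] xp] := (kP j).2 (row j x) t (Gx j) xjM t01.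
      exact: le_trans (dot_prod_set_row _ Gx) xz.
    by exists p.
have rowp j : row j (\matrix_(i, l) p i 0 l) = p j by apply/rowP => l; rewrite !mxE.
exists (\matrix_(i, l) p i 0 l).
  rewrite prod_set_orth => j; rewrite rowp orthogonal_compl1E.
  by have [? ? _] := pP j.
apply: le_trans (enorm_rows _) _; rewrite mulr_suml; apply: ler_sum => j _.
by rewrite linearB /= rowp; have [] := pP j.
Qed.

End Step.
End Blocks.

(** * The error bound along a chain satisfying SANE *)

Section ErrorBound.
Context {R : realType}.

Section Dist.
Context {p q : nat}.
Implicit Types (x y : 'M[R]_(p, q)) (C : set 'M[R]_(p, q)).

Lemma dist_le x y C : C y -> dist x C <= enorm (x - y).
Proof.
move=> Cy; apply: ge_inf; last by exists y.
by exists 0 => _ [u _ <-]; exact: enorm_ge0.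
Qed.

Lemma dist_ge0 x C : C !=set0 -> 0 <= dist x C.
Proof.
move=> [y Cy]; apply: lb_le_inf; first by exists (enorm (x - y)); exists y.
by move=> _ [u _ <-]; exact: enorm_ge0.
Qed.

Lemma dist_lt x C e : C !=set0 -> dist x C < e -> exists2 y, C y & enorm (x - y) <= e.
Proof.
move=> [y Cy]; rewrite -subr_gt0 => h.
have [|_ [u Cu <-] hu] := inf_adherent h (E := [set enorm (x - y) | y in C]).
  split; first by exists (enorm (x - y)); exists y.
  by exists 0 => _ [u _ <-]; exact: enorm_ge0.
by exists u => //; apply/ltW/(lt_le_trans hu); rewrite /dist; lra.
Qed.

End Dist.

Context {m : nat}.
Implicit Types (L : {vspace 'M[R]_(m, 3)}) (a x : 'M[R]_(m, 3)).

Lemma K_exp_prodE : K_exp_prod R m = prod_set (fun=> K_exp).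
Proof. by []. Qed.

Lemma fin_gen0 (G : set 'rV[R]_3) : fin_gen G -> G 0.
Proof.
move=> [n [g ->]]; exists (fun=> 0) => //.
by rewrite big1 // => i _; rewrite scale0r.
Qed.

(** Finitely generated blocks stay so under cutting. A block still equal to [K_exp] needs that its
    next face is not [F_infty], so the residual at step [i] rests on non-exceptionality at
    [i.+1]. *)
Lemma sane_faces (d : nat) (F : nat -> set 'M[R]_(m, 3)) (z : nat -> 'M[R]_(m, 3)) :
  F 0%N = K_exp_prod R m ->
  (forall i, (i < d)%N -> dual_cone (F i) (z i)) ->
  (forall i, (i < d)%N -> F i.+1 = F i `&` orthogonal_compl [set z i]) ->
  (forall i, (i <= d)%N -> forall j : 'I_m, block (F i) j <> F_infty) ->
  forall i, (i <= d)%N -> exists G, [/\ F i = prod_set G,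
    forall j, G j = K_exp \/ fin_gen (G j) &
    (i < d)%N -> forall j, half_residual (G j) (row j (z i))].
Proof.
move=> F0 zF FS nF.
have G0 (G : 'I_m -> set 'rV[R]_3) : (forall j, G j = K_exp \/ fin_gen (G j)) ->
    forall j, G j 0.
  by move=> hG j; have [->|/fin_gen0//] := hG j; exact: K_exp0.
have res i G : F i = prod_set G -> (forall j, G j = K_exp \/ fin_gen (G j)) ->
    (i < d)%N -> forall j, half_residual (G j) (row j (z i)) /\
    (G j `&` orthogonal_compl [set row j (z i)] = K_exp \/
     fin_gen (G j `&` orthogonal_compl [set row j (z i)])).
  move=> FG hG id j.
  have zG : dual_cone (prod_set G) (z i) by rewrite -FG; exact: zF.
  have zj : dual_cone (G j) (row j (z i)) by exact: (@dual_prod_set R m G (z i) (G0 G hG) zG j).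
  have [GK|fG] := hG j; last first.
    by split; [exact: fin_gen_residual|right; exact: fin_gen_orth].
  rewrite GK in zj *; apply: exp_residual => //.
  have := nF i.+1 id j; rewrite FS // FG prod_set_orth //; last exact: G0.
  rewrite block_prod_set ?GK // => l; split; first exact: G0.
  by move=> _ ->; rewrite dot0r.
elim=> [|i IH] id.
  exists (fun=> K_exp); split=> // [j|d0 j]; first by left.
  by have [] := res _ _ F0 (fun=> or_introl erefl) d0 j.
have [G [FG hG _]] := IH (ltnW id).
pose G' j := G j `&` orthogonal_compl [set row j (z i)].
have hG' j : G' j = K_exp \/ fin_gen (G' j) by exact: (res i G FG hG id j).2.
have FG' : F i.+1 = prod_set G'.
  by rewrite FS // FG prod_set_orth //; [exact: G0|rewrite -FG; exact: zF].
by exists G'; split=> // id' j; have [] := res _ _ FG' hG' id' j.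
Qed.

(** The induction hypothesis is used at [t ^+ 2], as t^(2^(i+1)) = (t^2)^(2^i): it places [w] in
    [F i] within O(t^2), and the residual bound trades this for O(t). *)
Lemma sane_near L a (d : nat) (F : nat -> set 'M[R]_(m, 3)) (z : nat -> 'M[R]_(m, 3)) :
  F 0%N = K_exp_prod R m ->
  (forall i, (i < d)%N -> [/\ dual_cone (F i) (z i),
     orthogonal_compl [set` L] (z i) & orthogonal_compl [set a] (z i)]) ->
  (forall i, (i < d)%N -> F i.+1 = F i `&` orthogonal_compl [set z i]) ->
  (forall i, (i <= d)%N -> forall j : 'I_m, block (F i) j <> F_infty) ->
  forall i, (i <= d)%N -> forall M, exists2 k, 0 <= k & forall x y v t,
    enorm x <= M -> 0 <= t <= 1 -> K_exp_prod R m y -> affine L a v ->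
    enorm (x - y) <= t ^+ (2 ^ i) -> enorm (x - v) <= t ^+ (2 ^ i) ->
    exists2 w, F i w & enorm (x - w) <= k * t.
Proof.
move=> F0 zP FS nF; elim=> [|i IH] id M.
  exists 1 => // x y v t _ _ Ky _ xy _; exists y; first by rewrite F0.
  by rewrite mul1r.
have zF j : (j < d)%N -> dual_cone (F j) (z j) by move=> /zP[].
have [k k0 kP] := IH (ltnW id) M.
have [G [FG hG hr]] := sane_faces F0 zF FS nF (ltnW id).
have [zd zL za] := zP i id.
(* Large enough both for the norm of [w] and for the coefficient of [t ^+ 2] in its product with
   [z i]. *)
pose N := `|M| + k + enorm (z i) * (k + 1).
have G0 j : G j 0 by have [->|/fin_gen0//] := hG j; exact: K_exp0.
have zG : dual_cone (prod_set G) (z i) by rewrite -FG.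
have [k' k'0 k'P] := prod_set_residual G0 zG (hr id) N.
exists (k + k') => [|x y v t xM /andP[t0 t1] Ky Vv]; first exact: addr_ge0.
rewrite expnS exprM => xy xv.
have t20 : 0 <= t ^+ 2 := sqr_ge0 t.
have tt : t ^+ 2 <= t by nra.
have t21 : 0 <= t ^+ 2 <= 1 by rewrite t20 (le_trans tt).
have [w Fw xw] := kP x y v _ xM t21 Ky Vv xy xv.
have xv2 : enorm (x - v) <= t ^+ 2.
  apply: le_trans xv _; rewrite -[leRHS]expr1.
  by apply: ler_wiXn2l; rewrite ?expn_gt0 ?(andP t21).1 ?(andP t21).2.
have vz : dot v (z i) = 0.
  case: Vv => l Ll <-; rewrite dotDl (zL _ Ll); have -> := za a erefl.
  by rewrite addr0.
have wz : dot w (z i) <= enorm (z i) * (k + 1) * t ^+ 2.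
  have -> : dot w (z i) = dot (w - x) (z i) + dot (x - v) (z i).
    by rewrite !dotBl vz; ring.
  have h1 := dot_le (w - x) (z i); have h2 := dot_le (x - v) (z i).
  have z0 := enorm_ge0 (z i).
  have h3 : enorm (w - x) * enorm (z i) <= k * t ^+ 2 * enorm (z i).
    by rewrite ler_wpM2r // enorm_distC.
  have h4 : enorm (x - v) * enorm (z i) <= t ^+ 2 * enorm (z i).
    by rewrite ler_wpM2r.
  by lra.
have zk : 0 <= enorm (z i) * (k + 1) by rewrite mulr_ge0 ?enorm_ge0 // addr_ge0.
have [|||| w' Fw' ww'] := k'P w t.
- by rewrite -FG.
- have := ler_enorm_distD x w 0; rewrite !subr0 (enorm_distC w) => h.
  have kt : k * t ^+ 2 <= k by rewrite ler_piMr // (andP t21).2.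
  by have := ler_norm M; rewrite /N; lra.
- by rewrite t0.
- apply: le_trans wz _; rewrite ler_wpM2r // /N lerDr addr_ge0 //.
exists w'; first by rewrite FS // FG.
have := ler_enorm_distD w x w'; have : k * t ^+ 2 <= k * t by rewrite ler_wpM2l.
by lra.
Qed.

Lemma K_exp_prod_cone : convex_cone (K_exp_prod R m).
Proof.
have [_ /convex_setP cK sK] := @K_exp_cone R.
split.
- by exists 0 => i; rewrite linear0; exact: K_exp0.
- apply/convex_setP => x y t t01 Kx Ky i.
  by rewrite linearD !linearZ /=; exact: (cK _ _ _ t01 (Kx i) (Ky i)).
- by move=> t x t0 Kx i; rewrite linearZ /=; exact: (sK _ _ t0 (Kx i)).
Qed.

Lemma sane_holder L a (d : nat) (F : nat -> set 'M[R]_(m, 3)) (z : nat -> 'M[R]_(m, 3)) :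
  affine L a `&` K_exp_prod R m !=set0 ->
  PPS_chain (K_exp_prod R m) (affine L a) d F ->
  (forall i, (i < d)%N -> [/\ dual_cone (F i) (z i),
     orthogonal_compl [set` L] (z i) & orthogonal_compl [set a] (z i)]) ->
  (forall i, (i < d)%N -> F i.+1 = F i `&` orthogonal_compl [set z i]) ->
  (forall i, (i <= d)%N -> forall j : 'I_m, block (F i) j <> F_infty) ->
  unif_holder (K_exp_prod R m) (affine L a) (2 ^- d).
Proof.
move=> [u [Vu Ku]] [[F0 Ff _] FV FP] zP FS nF.
have [_ cK _] := K_exp_prod_cone.
have KV0 : K_exp_prod R m `&` affine L a !=set0 by exists u.
split=> //; first exact: affine_convex.
  by rewrite invr_gt0 exprn_gt0 // invf_le1 ?exprn_gt0 // exprn_ege1 // ler1n.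
move=> B [M BM].
have [k k0 kP] := sane_near F0 zP FS nF (leqnn d) M.
have [_ [_ cF _] _ _] := Ff d (leqnn d).
have [l l0 lP] := PPS_regular cF FP M.
(* The first term is the actual constant; the second forces [t <= 1] below; the 1 gives positivity
   and the final strict contradiction. *)
pose kappa := l * (k + 1) + (`|M| + enorm u) + 1.
have lk : 0 <= l * (k + 1) by rewrite mulr_ge0 // addr_ge0.
have Mu : 0 <= `|M| + enorm u by rewrite addr_ge0 ?enorm_ge0.
have kappa0 : 0 < kappa by rewrite /kappa; lra.
exists kappa => // x Bx; have xM := BM x Bx.
set D := dist x _; set e := Num.max _ _; rewrite leNgt; apply/negP => De.
have e0 : 0 <= e by rewrite le_max dist_ge0 //; exact: (ex_intro _ u Ku).
(* If the bound fails, both distances are strictly below [t ^+ (2 ^ d)], so points of the two sets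
   within that distance exist without attained infima. *)
pose t := D / kappa.
have et : e `^ (2 ^- d) < t by rewrite /t ltr_pdivlMr // (mulrC _ kappa).
have t0 : 0 < t := le_lt_trans (powR_ge0 _ _) et.
have Dt : D = kappa * t by rewrite /t mulrC divfK // gt_eqF.
have D1 : D <= `|M| + enorm u.
  apply: le_trans (dist_le x (conj Ku Vu)) _; apply: le_trans (ler_enormD _ _) _.
  by rewrite enormN lerD // (le_trans xM) // ler_norm.
have t1 : t <= 1 by rewrite /t ler_pdivrMr // mul1r /kappa; lra.
have {}et : e < t ^+ (2 ^ d).
  have -> : e = (e `^ (2 ^- d)) ^+ (2 ^ d).
    by rewrite -powR_mulrn ?powR_ge0 // -powRrM natrX mulVf ?powRr1 //.
  by rewrite ltr_pXn2r ?expn_gt0 // nnegrE ?powR_ge0 // ltW.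
move: et; rewrite gt_max => /andP[eK eV].
have [y Ky xy] := dist_lt (ex_intro _ u Ku) eK.
have [v Vv xv] := dist_lt (ex_intro _ u Vu) eV.
have t01 : 0 <= t <= 1 by rewrite ltW.
have [w Fw xw] := kP x y v t xM t01 Ky Vv xy xv.
have xw' : enorm (x - w) <= (k + 1) * t by apply: le_trans xw _; rewrite ler_wpM2r ?lerDl // ltW.
have xv' : enorm (x - v) <= (k + 1) * t.
  apply: le_trans xv _; apply: (@le_trans _ _ t).
    by rewrite -[leRHS]expr1 ler_wiXn2l ?expn_gt0 // ltW.
  by apply: ler_peMl; [exact: ltW|rewrite lerDr].
have [s Fs xs] := lP x w v _ xM Fw Vv xw' xv'.
have : D <= l * (k + 1) * t.
  by apply: le_trans (dist_le x _) _; [rewrite -FV; exact: Fs|rewrite -mulrA].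
rewrite Dt ler_pM2r // /kappa; lra.
Qed.

End ErrorBound.

(** * Exposed faces and coordinate embeddings *)

Section Faces.
Context {R : realType} {p q : nat}.
Implicit Types (x y z : 'M[R]_(p, q)) (C S : set 'M[R]_(p, q)).

Lemma continuous_dot x : continuous (dot x).
Proof.
have cD : continuous (fun u : R * R => u.1 + u.2).
  by move=> u; apply: cvgD; [exact: cvg_fst|exact: cvg_snd].
apply: continuous_big => // i _; apply: continuous_big => // j _ y.
apply: (@continuousM R _ (fun=> x i j) (fun u : 'M[R]_(p, q) => u i j)).
  exact: cst_continuous.
exact: coord_continuous.
Qed.

Lemma closed_dual_cone S : closed (dual_cone S).
Proof.
rewrite (_ : dual_cone S = \bigcap_(x in S) [set z | 0 <= dot x z]) //.
apply: closed_bigI => x _.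
have /continuous_closedP h := @continuous_dot x; exact: (h [set r | 0 <= r] (@closed_ge R 0)).
Qed.

Lemma dual_cone_cone S : convex_cone (dual_cone S).
Proof.
split; first by exists 0 => x _; rewrite dot0r.
- apply/convex_setP => x y t /andP[t0 t1] hx hy v Sv.
  by rewrite dotDr !dotZr addr_ge0 // mulr_ge0 ?hx ?hy // subr_ge0.
- by move=> t x t0 hx v Sv; rewrite dotZr mulr_ge0 ?hx.
Qed.

Lemma dual_coneI S C : dual_cone S `&` dual_cone C = dual_cone (S `|` C).
Proof.
apply/seteqP; split=> x; first by move=> [h1 h2] y [/h1|/h2].
by move=> h; split=> y hy; apply: h; [left|right].
Qed.

Lemma exposed_face S z : dual_cone (dual_cone S) z ->
  face (dual_cone S) (dual_cone S `&` orthogonal_compl [set z]).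
Proof.
move=> zC.
(* Written as the dual cone of a larger set, the exposed face is closed and convex at once. *)
have -> : dual_cone S `&` orthogonal_compl [set z] = dual_cone (S `|` [set - z]).
  rewrite -dual_coneI; apply/seteqP; split=> x [Sx hx]; split=> // _ ->.
    by rewrite dotNl hx // oppr0.
  by have := hx _ erefl; rewrite dotNl oppr_ge0 => zx; apply/eqP; rewrite eq_le zx dotC zC.
split.
- exact: closed_dual_cone.
- exact: dual_cone_cone.
- by rewrite -dual_coneI; exact: subIsetl.
- move=> x y Cx Cy; rewrite -!dual_coneI => -[_ /(_ _ erefl)].
  rewrite dotNl dotDr => h; have := zC x Cx; have := zC y Cy.
  rewrite !(dotC _ z) => zy zx.
  by split; split=> // _ ->; rewrite dotNl; lra.
Qed.

(** The summation makes the map linear for every [t]; for injective [t] each sum has at most one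
    term, and entries outside the image are 0. *)
Definition lift_coord (n : nat) (t : 'I_n -> 'I_p * 'I_q) (c : 'rV[R]_n) : 'M[R]_(p, q) :=
  \matrix_(i, k) \sum_(l | t l == (i, k)) c 0 l.

Lemma lift_coord_linear n (t : 'I_n -> 'I_p * 'I_q) : linear (lift_coord t).
Proof.
move=> a x y; apply/matrixP => i k; rewrite !mxE mulr_sumr -big_split.
by apply: eq_bigr => l _; rewrite !mxE.
Qed.

Lemma lift_coordE n (t : 'I_n -> 'I_p * 'I_q) c l : injective t ->
  lift_coord t c (t l).1 (t l).2 = c 0 l.
Proof.
move=> inj; rewrite mxE (eq_bigl (pred1 l)) ?big_pred1_eq // => l' /=.
by rewrite -surjective_pairing (inj_eq inj).
Qed.

Lemma lift_coord0 n (t : 'I_n -> 'I_p * 'I_q) c i k :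
  (forall l, t l != (i, k)) -> lift_coord t c i k = 0.
Proof. by move=> h; rewrite mxE big_pred0 // => l; exact: negbTE. Qed.

Lemma linear_cone p' q' (f : 'M[R]_(p, q) -> 'M[R]_(p', q')) (D : set 'M[R]_(p', q')) :
  linear f -> convex_cone D -> convex_cone [set x | D (f x)].
Proof.
move=> lf [[d Dd] cD sD].
have f0 : f 0 = 0.
  by have := lf (-1) 0 0; rewrite !scaleN1r !addNr.
split; last 1 first.
- move=> t x t0 Dx /=; rewrite -[t *: x]addr0 lf f0 addr0; exact: sD.
- by exists 0; rewrite /= f0 -(scale0r d); exact: sD.
- exact: linear_convex.
Qed.

End Faces.

(** * Midpoint-convex subsets of the boundary of the exponential cone *)

Section KExpFaces.
Context {R : realType}.

Definition int_exp (v : 'rV[R]_3) : Prop :=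
  0 < v 0 1 /\ v 0 1 * expR (v 0 0 / v 0 1) < v 0 2.

Lemma int_exp_nbhs v : int_exp v -> exists2 e : R, 0 < e &
  forall u : 'rV[R]_3, (forall k, `|u 0 k - v 0 k| < e) -> K_exp u.
Proof.
move=> [v1 v2].
pose f (u : 'rV[R]_3) := u 0 2 - u 0 1 * expR (u 0 0 / u 0 1).
have cc k : (fun u : 'rV[R]_3 => u 0 k) @ v --> v 0 k by exact: coord_continuous.
have c1 : (fun u : 'rV[R]_3 => u 0 0 / u 0 1) @ v --> v 0 0 / v 0 1.
  by apply: (cvgM (cc 0) (cvgV _ (cc 1))); exact: lt0r_neq0.
have c2 : (fun u : 'rV[R]_3 => expR (u 0 0 / u 0 1)) @ v --> expR (v 0 0 / v 0 1).
  apply: (@continuous_comp _ _ _ (fun u : 'rV[R]_3 => u 0 0 / u 0 1) expR v).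
    exact: c1.
  exact: continuous_expR.
have cf : f @ v --> f v by apply: (cvgB (cc 2) (cvgM (cc 1) c2)).
have near1 : nbhs v (fun u : 'rV[R]_3 => 0 < u 0 1) by exact: (cvgr_gt _ (cc 1) _ v1).
have near2 : nbhs v (fun u : 'rV[R]_3 => 0 < f u).
  by apply: (cvgr_gt _ cf); rewrite subr_gt0.
have [e /= e0 eP] := (nbhs_ballP _ _).1 (filterI near1 near2).
exists e => // u uv; have [|u1] := eP u.
  by split=> // i k; rewrite (ord1 i) /ball /= distrC; exact: uv.
by rewrite subr_gt0 => u2; left; split => //; exact: ltW.
Qed.

(** A point with y > 0 must lie on the graph, and strict convexity puts all of [S] on its tangent
    there; otherwise [S] lies in y = 0. The final clause makes the cut proper. *)
Lemma boundary_exposed (S : set 'rV[R]_3) :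
  S `<=` K_exp -> (forall v u, S v -> S u -> S (2^-1 *: (v + u))) ->
  (forall v, S v -> ~ int_exp v) ->
  exists u, [/\ dual_cone K_exp u, forall v, S v -> dot v u = 0,
    polyhedral (K_exp `&` orthogonal_compl [set u]) &
    exists2 k, K_exp k & dot k u <> 0].
Proof.
move=> SK Smid Sint.
have [[v [Sv v1]]|nv] := pselect (exists v, S v /\ 0 < v 0 1).
  have [[_ h]|[_ _ v0]] : (0 < v 0 1 /\ v 0 1 * expR (v 0 0 / v 0 1) <= v 0 2) \/
      [/\ v 0 0 <= 0, 0 <= v 0 2 & v 0 1 = 0] by exact: SK.
    set r := v 0 0 / v 0 1 in h.
    have vE : v 0 0 = r * v 0 1 by rewrite /r divfK // gt_eqF.
    have v2 : v 0 2 = v 0 1 * expR r.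
      apply/eqP; rewrite eq_le h andbT leNgt; apply/negP => ?; exact: (Sint v).
    have r0 := expR_gt0 r.
    pose u : 'rV[R]_3 := vec3 (- expR r) (- (expR r * (1 - r))) 1.
    have uE w : dot w u = w 0 2 - expR r * (w 0 0 + (1 - r) * w 0 1).
      by rewrite dot3 !vec3E; ring.
    have uK : dual_cone K_exp u.
      by move=> w /K_expP[_ _ /(_ r)]; rewrite uE subr_ge0.
    exists u; split=> //.
    - move=> w Sw; rewrite uE.
      have [w1 w2 wt] := (K_expP w).1 (SK w Sw).
      set Y := v 0 1 + w 0 1; have Y0 : 0 < Y by rewrite ltr_wpDr.
      pose b := (v 0 0 + w 0 0) / Y; have b0 := expR_gt0 b.
      have bE : v 0 0 + w 0 0 = b * Y by rewrite /b divfK // gt_eqF.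
      have hY : v 0 2 + w 0 2 <= Y * expR b.
        rewrite leNgt; apply/negP => lt; apply: (Sint _ (Smid v w Sv Sw)).
        rewrite /int_exp !mxE; split; first by rewrite mulr_gt0.
        have -> : 2^-1 * (v 0 0 + w 0 0) / (2^-1 * (v 0 1 + w 0 1)) = b.
          by rewrite /b /Y; field; exact: lt0r_neq0.
        by rewrite -/Y -mulrA ltr_pM2l.
      have eE : expR r = expR b * expR (r - b) by rewrite -expRD addrC subrK.
      have ph : 0 <= v 0 1 * (expR b * phi (r - b)).
        by rewrite !mulr_ge0 ?phi_ge0 // ltW.
      have wb := wt b.
      (* The height of [v + w] over the graph is nonpositive by [hY], yet it is a sum of nonnegative
         terms; hence b = r and [w] lies on the tangent of slope r. *)
      have split_eq : v 0 2 + w 0 2 - Y * expR b = v 0 1 * (expR b * phi (r - b)) +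
          (w 0 2 - expR b * (w 0 0 + (1 - b) * w 0 1)).
        rewrite (_ : w 0 0 = b * Y - v 0 0); last by rewrite -bE; ring.
        by rewrite v2 vE /phi eE /Y; ring.
      have /eqP : v 0 1 * (expR b * phi (r - b)) = 0 by lra.
      rewrite !mulf_eq0 (gt_eqF v1) (gt_eqF b0) => /eqP/phi_eq0/eqP.
      by rewrite subr_eq0 => /eqP ->; lra.
    - rewrite exp_exposed_ray //; last 2 first.
      + by rewrite vec3E oppr_lt0.
      + by rewrite !vec3E opprK divr1 expRK; ring.
      rewrite !vec3E opprK divr1 expRK.
      (* The ray spanned by (r, 1, e^r) is x = r y, z = e^r y, y >= 0. *)
      rewrite [X in polyhedral X](_ : _ = [set w | dot (vec3 1 (- r) 0) w = 0] `&`
        ([set w | dot (vec3 0 (- expR r) 1) w = 0] `&` [set w | dot (vec3 0 (-1) 0) w <= 0])).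
        by do 2?apply: polyhedralI; [exact: polyhedral_eq|exact: polyhedral_eq|exact: polyhedral_le].
      apply/seteqP; split=> w /=; rewrite !dot3 !vec3E.
        move=> [b b0 <-]; rewrite !mxE /=.
        by split; [|split]; lra.
      move=> [h1 [h2 h3]]; exists (w 0 1); first by lra.
      by apply: row3P; rewrite mxE vec3E; lra.
    - by exists (vec3 0 0 1); [exact: K_exp_up|rewrite uE !vec3E; lra].
  by rewrite v0 ltxx in v1.
have y0 v : S v -> v 0 1 = 0.
  move=> Sv; have [y0 _ _] := (K_expP v).1 (SK v Sv).
  by apply/eqP; rewrite eq_le y0 andbT leNgt; apply/negP => v1; apply: nv; exists v.
exists (vec3 0 1 0); split.
- by move=> v /K_expP[v1 _ _]; rewrite dot3 !vec3E; lra.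
- by move=> v /y0 v1; rewrite dot3 !vec3E v1; ring.
- rewrite (_ : _ `&` _ = [set v | dot (vec3 0 1 0) v = 0] `&`
    ([set v | dot (vec3 1 0 0) v <= 0] `&` [set v | dot (vec3 0 0 (-1)) v <= 0])).
    by do 2?apply: polyhedralI; [exact: polyhedral_eq|exact: polyhedral_le|exact: polyhedral_le].
  rewrite orthogonal_compl1E; apply/seteqP; split=> v /=; rewrite !dot3 !vec3E.
    move=> [Kv v1]; have {}v1 : v 0 1 = 0 by lra.
    case: Kv => [[]|[x0 z0 _]]; first by rewrite v1 ltxx.
    by rewrite v1; split; [|split]; lra.
  move=> [v1 [v0 v2]]; split; last lra.
  by right; split; lra.
- exists (vec3 0 1 (expR 0)); first exact: K_exp_graph.
  by rewrite dot3 !vec3E mul0r mulr0 addr0 add0r mulr1 => /eqP; rewrite oner_eq0.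
Qed.

End KExpFaces.

(** * A chain of at most [m] cuts reaching the PPS condition *)

Section FacialChain.
Context {R : realType} {m : nat}.
Implicit Types (x y z : 'M[R]_(m, 3)) (v : 'rV[R]_3).

(** The cone is its own bidual: it suffices to test against the functionals y, z and the tangents of
    each block. *)
Lemma K_exp_prod_dual : exists S, K_exp_prod R m = dual_cone S.
Proof.
exists (dual_cone (K_exp_prod R m)); apply/seteqP; split=> x Kx.
  by move=> z zK; rewrite dotC zK.
have test (j : 'I_m) (u : 'rV[R]_3) : dual_cone K_exp u -> 0 <= dot u (row j x).
  move=> uK; rewrite -dot_emb; apply: Kx => y Ky; rewrite dotC dot_emb dotC uK //.
move=> j; apply/K_expP; split=> [||r].
- have := test j (vec3 0 1 0); rewrite dot3 !vec3E !mul0r mul1r add0r addr0; apply.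
  by move=> v /K_expP[v1 _ _]; rewrite dot3 !vec3E; lra.
- have := test j (vec3 0 0 1); rewrite dot3 !vec3E !mul0r mul1r !add0r; apply.
  by move=> v /K_expP[_ v2 _]; rewrite dot3 !vec3E; lra.
- have := test j (vec3 (- expR r) (- (expR r * (1 - r))) 1); rewrite dot3 !vec3E => h.
  have : 0 <= - expR r * row j x 0 0 + - (expR r * (1 - r)) * row j x 0 1 + 1 * row j x 0 2.
    by apply: h => v /K_expP[_ _ /(_ r)]; rewrite dot3 !vec3E; lra.
  lra.
Qed.

Lemma exposed_face_prod z : dual_cone (K_exp_prod R m) z ->
  face (K_exp_prod R m) (K_exp_prod R m `&` orthogonal_compl [set z]).
Proof. by have [S ->] := K_exp_prod_dual; exact: exposed_face. Qed.

(** One functional cuts all blocks of [bd] at once, so each member of the chain is an exposed face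
    of the whole product and no transitivity of faces is needed. *)
Definition cut_mx (u : 'I_m -> 'rV[R]_3) (bd : pred 'I_m) : 'M[R]_(m, 3) :=
  \matrix_(j, k) (if bd j then u j 0 k else 0).

Definition cut_face (u : 'I_m -> 'rV[R]_3) (bd : pred 'I_m) : set 'M[R]_(m, 3) :=
  K_exp_prod R m `&` orthogonal_compl [set cut_mx u bd].

Lemma row_cut_mx (u : 'I_m -> 'rV[R]_3) (bd : pred 'I_m) j : row j (cut_mx u bd) = if bd j then u j else 0.
Proof. by apply/rowP => k; rewrite !mxE; case: ifP => // _; rewrite mxE. Qed.

Section CutFace.
Variables (u : 'I_m -> 'rV[R]_3) (bd : pred 'I_m).
Hypothesis uK : forall j, bd j -> dual_cone K_exp (u j).

Lemma dual_cut_mx : dual_cone (K_exp_prod R m) (cut_mx u bd).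
Proof.
move=> x Kx; rewrite dot_rows; apply: sumr_ge0 => j _; rewrite row_cut_mx.
by case: ifPn => [/uK|_]; [apply; exact: Kx|rewrite dot0r].
Qed.

Lemma cut_faceP x : cut_face u bd x <->
  (forall j, K_exp (row j x)) /\ (forall j, bd j -> dot (row j x) (u j) = 0).
Proof.
rewrite /cut_face K_exp_prodE prod_set_orth; first last.
- exact: dual_cut_mx.
- by move=> j; exact: K_exp0.
split=> [h|[h1 h2] j].
  split=> j; first exact: (h j).1.
  by move=> bj; have := (h j).2; rewrite orthogonal_compl1E /= row_cut_mx bj.
split=> //; rewrite orthogonal_compl1E /= row_cut_mx.
by case: ifPn => [/h2|]; rewrite ?dot0r.
Qed.

Lemma cut_face_face : face (K_exp_prod R m) (cut_face u bd).
Proof. exact/exposed_face_prod/dual_cut_mx. Qed.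

Lemma cut_face_cone : convex_cone (cut_face u bd).
Proof. by have [] := cut_face_face. Qed.

Hypothesis pu : forall j, bd j -> polyhedral (K_exp `&` orthogonal_compl [set u j]).

(** The cut blocks form the polyhedral factor and the others, full copies of [K_exp], the second
    factor, in which [x] is interior. Each factor is the preimage of the face under padding by
    zeros. *)
Lemma cut_face_PPS V x : cut_face u bd x -> V x ->
  (forall j, ~~ bd j -> int_exp (row j x)) -> PPS (cut_face u bd) V.
Proof.
move=> Fx Vx xint; apply: Or33.
pose P1 := finset (fun jk : 'I_m * 'I_3 => bd jk.1).
pose t1 (l : 'I_#|P1|) := enum_val l; pose t2 (l : 'I_#|~: P1|) := enum_val l.
pose s (l : 'I_#|P1| + 'I_#|~: P1|) := match l with inl i => t1 i | inr i => t2 i end.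
have t1P l : bd (t1 l).1 by have := enum_valP l; rewrite inE.
have t2P l : ~~ bd (t2 l).1 by have := enum_valP l; rewrite !inE.
have t1inj : injective t1 by exact: enum_val_inj.
have t2inj : injective t2 by exact: enum_val_inj.
have t1S j k : bd j -> exists l, t1 l = (j, k).
  move=> bj; have jk : (j, k) \in P1 by rewrite inE.
  by exists (enum_rank_in jk (j, k)); rewrite /t1 enum_rankK_in.
have t2S j k : ~~ bd j -> exists l, t2 l = (j, k).
  move=> bj; have jk : (j, k) \in ~: P1 by rewrite !inE.
  by exists (enum_rank_in jk (j, k)); rewrite /t2 enum_rankK_in.
pose C1 := [set c | cut_face u bd (lift_coord t1 c)].
pose C2 := [set c | cut_face u bd (lift_coord t2 c)].
have row1 c j : ~~ bd j -> row j (lift_coord t1 c) = 0 :> 'rV[R]_3.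
  move=> bj; apply/rowP => k; rewrite [LHS]mxE [RHS]mxE lift_coord0 // => l.
  by apply/eqP => h; have := t1P l; rewrite h (negbTE bj).
have row2 c j : bd j -> row j (lift_coord t2 c) = 0 :> 'rV[R]_3.
  move=> bj; apply/rowP => k; rewrite [LHS]mxE [RHS]mxE lift_coord0 // => l.
  by apply/eqP => h; have := t2P l; rewrite h bj.
pose p1 y : 'rV[R]_#|P1| := \row_l y (t1 l).1 (t1 l).2.
pose p2 y : 'rV[R]_#|~: P1| := \row_l y (t2 l).1 (t2 l).2.
have row1p y j : bd j -> row j (lift_coord t1 (p1 y)) = row j y.
  move=> bj; apply/rowP => k; rewrite [LHS]mxE [RHS]mxE; have [l tl] := t1S j k bj.
  by have := lift_coordE (p1 y) l t1inj; rewrite [RHS]mxE tl.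
have row2p y j : ~~ bd j -> row j (lift_coord t2 (p2 y)) = row j y.
  move=> bj; apply/rowP => k; rewrite [LHS]mxE [RHS]mxE; have [l tl] := t2S j k bj.
  by have := lift_coordE (p2 y) l t2inj; rewrite [RHS]mxE tl.
have FE : cut_face u bd = dprod_set s C1 C2.
  apply/seteqP; split=> y.
    move=> /cut_faceP[y1 y2]; split; apply/cut_faceP; split=> j.
    - by have [/row1p ->//|/row1 ->] := boolP (bd j); exact: K_exp0.
    - by move=> bj; rewrite row1p // y2.
    - by have [/row2 ->|/row2p ->//] := boolP (bd j); exact: K_exp0.
    - by move=> bj; rewrite row2 // dot0l.
  move=> [/cut_faceP[y1 y2] /cut_faceP[y3 _]]; apply/cut_faceP; split=> j.
    have [bj|bj] := boolP (bd j); first by rewrite -row1p.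
    by rewrite -row2p.
  by move=> bj; rewrite -row1p // y2.
have [Fx1 Fx2] : dprod_set s C1 C2 x by rewrite -FE.
exists #|P1|, #|~: P1|, s, C1, C2; split=> //.
- apply: inj_card_bij; last by rewrite card_sum !card_ord cardsC.
  move=> [l|l] [l'|l'] //= h; first by rewrite (t1inj _ _ h).
  + by have := t1P l; rewrite h (negbTE (t2P l')).
  + by have := t1P l'; rewrite -h (negbTE (t2P l)).
  + by rewrite (t2inj _ _ h).
- by split; apply: linear_cone; try exact: lift_coord_linear; exact: cut_face_cone.
- rewrite (_ : C1 = [set c | forall j, (if bd j then
      [set c | (K_exp `&` orthogonal_compl [set u j]) (row j (lift_coord t1 c))]
      else setT) c]).
    apply: polyhedral_bigcap => j; case: ifPn => bj; last exact: polyhedralT.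
    apply: polyhedral_preimage; last exact: pu.
    by move=> a c c'; rewrite lift_coord_linear linearP.
  apply/seteqP; split=> c /=.
    move=> /cut_faceP[c1 c2] j; case: ifPn => // bj; split; first exact: c1.
    by rewrite orthogonal_compl1E; exact: c2.
  move=> h; apply/cut_faceP; split=> j.
    have := h j; case: ifPn => [bj [] //|bj _]; rewrite row1 //; exact: K_exp0.
  by move=> bj; have := h j; rewrite bj orthogonal_compl1E => -[].
exists x; split=> //; split=> //; split=> //.
have /choice[e eP] : forall j, exists e : R, 0 < e /\ (~~ bd j ->
    forall v, (forall k, `|v 0 k - row j x 0 k| < e) -> K_exp v).
  move=> j; have [bj|bj] := boolP (bd j); first by exists 1.
  by have [e e0 eP] := int_exp_nbhs (xint j bj); exists e.
have [d d0 dP] : exists2 d, 0 < d & forall j, d <= e j.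
  (* The default 1 keeps the minimum positive also when there are no blocks. *)
  exists (\big[Num.min/1]_j e j) => [|j]; last exact: bigmin_le_cond.
  by apply: lt_bigmin => // j _; exact: (eP j).1.
exists d => // c _ cd; apply/cut_faceP; split=> j; last first.
  by move=> bj; rewrite row2 // dot0l.
have [bj|bj] := boolP (bd j); first by rewrite row2 //; exact: K_exp0.
apply: ((eP j).2 bj) => k; rewrite mxE [row j x 0 k]mxE.
have [l tl] := t2S j k bj.
have := lift_coordE c l t2inj; rewrite tl /= => ->.
apply: lt_le_trans (dP j); apply: le_lt_trans cd.
have := enorm_entry (c - p2 x) 0 l; rewrite !mxE tl; exact.
Qed.

End CutFace.

Lemma K_exp_prod_chain (L : {vspace 'M[R]_(m, 3)}) a :
  affine L a `&` K_exp_prod R m !=set0 ->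
  exists2 d, (d <= m)%N & exists F, PPS_chain (K_exp_prod R m) (affine L a) d F.
Proof.
move=> [x0 [Vx0 Kx0]].
pose inner j := exists2 x, (affine L a `&` K_exp_prod R m) x & int_exp (row j x).
pose bd j := ~~ `[< inner j >].
have midV x y : affine L a x -> affine L a y -> affine L a (2^-1 *: (x + y)).
  have /convex_setP cV := @affine_convex R m 3 L a.
  move=> Vx Vy; rewrite scalerDr; have := cV x y 2^-1.
  by rewrite (_ : 1 - 2^-1 = 2^-1 :> R); [apply=> //; lra|field].
have [_ _ sK] := @K_exp_prod_cone R m.
have midK x y : K_exp_prod R m x -> K_exp_prod R m y -> K_exp_prod R m (2^-1 *: (x + y)).
  by move=> Kx Ky; apply: sK => //; exact: (convex_coneD (@K_exp_prod_cone R m) Kx Ky).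
have /choice[u uP] : forall j, exists u, bd j -> [/\ dual_cone K_exp u,
    forall x, affine L a x -> K_exp_prod R m x -> dot (row j x) u = 0,
    polyhedral (K_exp `&` orthogonal_compl [set u]) &
    exists2 k, K_exp k & dot k u <> 0].
  move=> j; have [bj|nb] := boolP (bd j); last by exists 0.
  pose S := [set row j x | x in affine L a `&` K_exp_prod R m].
  have [||| u [uK uS pu uk]] := @boundary_exposed R S.
  - by move=> _ [x [_ Kx] <-]; exact: Kx.
  - move=> _ _ [x [Vx Kx] <-] [y [Vy Ky] <-].
    exists (2^-1 *: (x + y)); first by split; [exact: midV|exact: midK].
    by rewrite linearZ linearD.
  - by move=> _ [x Vx <-] ix; move/asboolPn: bj; apply; exists x.
  - by exists u => _; split=> // x Vx Kx; apply: uS; exists x.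
(* Tangents of one slope [b], that of the midpoint, are added for both points; the inequality of the
   interior point is strict. *)
have int_mid j x y : K_exp_prod R m x -> K_exp_prod R m y ->
    int_exp (row j x) \/ int_exp (row j y) -> int_exp (row j (2^-1 *: (x + y))).
  wlog ix : x y / int_exp (row j x).
    move=> h Kx Ky [i|i]; first by apply: h => //; left.
    by rewrite addrC; apply: h => //; left.
  move=> Kx Ky _; have [y1 y2 yt] := (K_expP _).1 (Ky j); have [x1 x2] := ix.
  set p := row j x in x1 x2 *; set q := row j y in y1 y2 yt *.
  rewrite (_ : row j _ = 2^-1 *: (p + q)); last by rewrite linearZ linearD /=.
  have Y0 : 0 < p 0 1 + q 0 1 by rewrite ltr_wpDr.
  have E k : (2^-1 *: (p + q)) 0 k = 2^-1 * (p 0 k + q 0 k) by rewrite !mxE.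
  split; rewrite !E; first by rewrite mulr_gt0.
  set b := _ / _; have bE : p 0 0 + q 0 0 = b * (p 0 1 + q 0 1).
    by rewrite /b; field; exact: lt0r_neq0.
  rewrite -mulrA ltr_pM2l //.
  have xt : expR b * (p 0 0 + (1 - b) * p 0 1) <= p 0 1 * expR (p 0 0 / p 0 1).
    have Kp : K_exp (vec3 (p 0 0) (p 0 1) (p 0 1 * expR (p 0 0 / p 0 1))).
      by left; rewrite !vec3E.
    by have [_ _ /(_ b)] := (K_expP _).1 Kp; rewrite !vec3E.
  have := yt b => ytb.
  have -> : (p 0 1 + q 0 1) * expR b = expR b * (p 0 0 + (1 - b) * p 0 1) +
      expR b * (q 0 0 + (1 - b) * q 0 1).
    by rewrite (_ : q 0 0 = b * (p 0 1 + q 0 1) - p 0 0); [ring|rewrite -bE; ring].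
  by rewrite ltr_leD // (le_lt_trans xt).
have [x [Vx Kx] xint] : exists2 x, (affine L a `&` K_exp_prod R m) x &
    forall j, j \in enum 'I_m -> ~~ bd j -> int_exp (row j x).
  elim: (enum 'I_m) => [|j s [x [Vx Kx] xs]]; first by exists x0.
  have [bj|] := boolP (bd j).
    by exists x => // i; rewrite inE => /predU1P[->|/xs//]; rewrite bj.
  move=> /negbNE/asboolP[y [Vy Ky] iy]; exists (2^-1 *: (x + y)).
    by split; [exact: midV|exact: midK].
  move=> i; rewrite inE => /predU1P[-> _|/xs h /h ix]; apply: int_mid => //.
    by right.
  by left.
(* The [i]-th face cuts the first [i] blocks of [s]. *)
pose s := enum bd; pose bd_ i : pred 'I_m := fun j => j \in take i s.
have bdS i j : bd_ i j -> bd j by move=> /mem_take; rewrite mem_enum.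
have uK i j : bd_ i j -> dual_cone K_exp (u j) by move=> /bdS/uP[].
have bdE : bd_ (size s) =1 bd by move=> j; rewrite /bd_ take_size mem_enum.
exists (size s).
  by rewrite -cardE; apply: leq_trans (max_card _) _; rewrite card_ord.
exists (fun i => cut_face u (bd_ i)); split.
- split=> [|i _|i si].
  + apply/seteqP; split=> y; first by move=> /(cut_faceP (uK 0%N))[].
    by move=> Ky; apply/(cut_faceP (uK 0%N)); split=> // j; rewrite /bd_ take0.
  + by apply: cut_face_face; exact: uK.
  + have [j0 _] : exists j0 : 'I_m, True.
      by case: {+}s si => // j0; exists j0.
    have takeS : take i.+1 s = rcons (take i s) (nth j0 s i) by exact: take_nth.
    have bj : bd (nth j0 s i) by have := mem_nth j0 si; rewrite mem_enum.
    have nbj : nth j0 s i \notin take i s.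
      have := take_uniq i.+1 (enum_uniq bd); rewrite -/s takeS rcons_uniq.
      by case/andP.
    split=> [y /(cut_faceP (uK i.+1))[y1 y2]|].
      apply/(cut_faceP (uK i)); split=> // j bij; apply: y2.
      by rewrite /bd_ takeS mem_rcons inE; apply/orP; right.
    (* Properness: [k] placed in the newly cut block, with zeros elsewhere, lies in face [i] but not
       in face [i.+1]. *)
    have [_ _ _ [k Kk k0]] := uP _ bj.
    move=> /(_ (emb (nth j0 s i) k)) h; apply: k0.
    have [|_ h2] := (cut_faceP (uK i.+1) _).1 (h _).
      apply/(cut_faceP (uK i)); split=> j; rewrite row_emb; case: eqP => [e|_] //.
      * exact: K_exp0.
      * by rewrite e /bd_ (negbTE nbj).
      * by rewrite dot0l.
    have := h2 (nth j0 s i); rewrite row_emb eqxx; apply.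
    by rewrite /bd_ takeS mem_rcons mem_head.
- apply/seteqP; split=> y; first by move=> [/(cut_faceP (uK (size s)))[]].
  move=> [Ky Vy]; split=> //; apply/(cut_faceP (uK (size s))); split=> // j.
  by move=> /bdS/uP[_ h _ _]; exact: h.
- apply: (cut_face_PPS (uK _) _ _ Vx).
  + by move=> j /bdS/uP[].
  + apply/(cut_faceP (uK (size s))); split=> // j.
    by move=> /bdS/uP[_ h _ _]; exact: h.
  + by move=> j; rewrite bdE; apply: xint; rewrite mem_enum.
Qed.

End FacialChain.

Theorem theorem4p17 (R : realType) (m : nat) (L : {vspace 'M[R]_(m, 3)})
    (a : 'M[R]_(m, 3)) (hne : affine L a `&` K_exp_prod R m !=set0) :
  exists d : nat,
    [/\ is_dPPS (K_exp_prod R m) (affine L a) d,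
        (d <= m)%N &
        SANE L a -> unif_holder (K_exp_prod R m) (affine L a) (2 ^- d)].
Proof.
have [d0 d0m [F0 F0P]] := K_exp_prod_chain hne.
pose P d := `[< exists F, PPS_chain (K_exp_prod R m) (affine L a) d F >].
have exP : exists d, P d by exists d0; apply/asboolP; exists F0.
case: (ex_minnP exP) => d /asboolP dP dmin.
have dmin' d' F : PPS_chain (K_exp_prod R m) (affine L a) d' F -> (d <= d')%N.
  by move=> F'P; apply: dmin; apply/asboolP; exists F.
exists d; split=> //; first exact: leq_trans (dmin' _ _ F0P) d0m.
move=> [d' [F [z [[[F' F'P] d'min] FP zP FS nF]]]].
(* Both lengths are minimal among PPS chains, so the chain provided by SANE has length parameter
   [d]. *)
have <- : d' = d.
  apply/eqP; rewrite eqn_leq (dmin' _ _ FP) andbT.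
  by have [F2 F2P] := dP; exact: d'min F2P.
exact: sane_holder hne FP zP FS nF.
Qed.
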